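(* None of the following circulant weighing matrices exists: $$CW(105,36),\quad CW(140,36),\quad CW(116,49),\quad CW(120,49),\quad CW(192,49),\quad CW(140,64),\quad CW(180,64),\quad CW(196,64).$$
   Context: A weighing matrix $W(v,n)$ is a square matrix $W$ of order $v$ with entries in $\{0,1,-1\}$ satisfying $WW^T=nI_v$; the integer $n$ is its weight. If each row after the first is a cyclic shift (by one position, indices modulo $v$) of the preceding row, i.e. $W$ is a circulant matrix, it is called a circulant weighing matrix and denoted by $CW(v,n)$. Equivalently, a $CW(v,n)$ is an element $A=\sum_{g\in C_v}a_g g$ of the integral group ring $\mathbb Z[C_v]$ of the cyclic group $C_v$ of order $v$ with all $a_g\in\{0,1,-1\}$ and $AA^{(-1)}=n$, where $A^{(-1)}=\sum_g a_g g^{-1}$ and the scalar $n$ means $n$ times the identity element. *)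

(* Defs.v *)
From mathcomp Require Import all_boot all_order all_algebra.

Set Implicit Arguments.
Unset Strict Implicit.
Unset Printing Implicit Defensive.

Import GRing.Theory.
Local Open Scope ring_scope.

Definition weighing_matrix (v n : nat) (W : 'M[int]_v) : Prop :=
  (forall i j : 'I_v, W i j \in [:: 0; 1; -1]) /\ W *m W^T = (n%:Z)%:M.

(* [ordS j] is [j + 1] modulo [v], so row [i + 1] is row [i] shifted by one
   position to the right. Shifting to the left instead only permutes the rows
   of the matrix, so it does not affect existence for a given order and weight. *)
Definition circulant (v : nat) (W : 'M[int]_v) : Prop :=
  forall i i' j : 'I_v, i' = i.+1 :> nat -> W i' (ordS j) = W i j.

Definition circulant_weighing_matrix (v n : nat) (W : 'M[int]_v) : Prop :=
  weighing_matrix n W /\ circulant W.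

Definition CW_exists (v n : nat) : Prop :=
  exists W : 'M[int]_v, circulant_weighing_matrix n W.

(* Main.v *)
(** View a CW(v, n) as an element A of Z[C_v] with A A^* = n, where [star] is
    the involution A^*. If a prime p not dividing v has p^m | n, then modulo p^m
    every ideal of Z[C_v] is stable under g -> g^p, so p^m divides
    [frob (p ^ j) A * star A]. Once n divides [frob t A * star A], the quotient is
    a unit of norm 1, hence up to sign a group element: [frob t A] is a translate
    of A, and a suitable translate of A is fixed by [frob t].

    When p | v (p = 3 for v = 105, p = 2 for n = 64), the same argument is run
    relative to the characters of order 3 or 4 on the p-part: for u in C_v of that
    order one works with A(1 - [u]), respectively A(1 - [2u]), and 1 - [u] takes
    over the role of p, as its square is associate to p there.

    An element fixed by [frob t] is constant on the orbits of t, and its images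
    in the quotients of C_v satisfy analogous equations. Verified searches along
    a chain of quotients enumerate all the possible images and end with none,
    except that for CW(140, 36) they leave images in Z[C_35] with coefficients
    0 and +-3, which do not lift to Z[C_70]. *)

Require Import Defs.
From HB Require Import structures.
From Stdlib Require Import ZArith.
From mathcomp Require Import all_boot all_order all_algebra.
From mathcomp Require Import zify ssrZ ring lra.

Set Implicit Arguments.
Unset Strict Implicit.
Unset Printing Implicit Defensive.

Import Order.TTheory GRing.Theory Num.Theory.

(** * The search *)

(** Stability of ideals is proved for elements, in any commutative ring with a finite-order lift of
    Frobenius, so no prime has to be factored in a cyclotomic field. In the ramified cases t is p
    modulo the prime-to-p part of v and 1 modulo its p-part: then [frob t] fixes u and still agrees
    with p-th powers modulo 1 - [u].

    A translate fixed by [frob t] requires a solution of (t - 1) x = - g, and here the cases differ.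
    Modulo 35 with t = 4 the factor 3 is invertible. For weight 49 the factor 6 is not, and the
    moment of A selects the translate instead. In the ramified cases t - 1 shares a factor with v,
    and A times the relative multiplier has augmentation 0, so at first neither g nor the sign is
    under control. Its image in C_3 or C_4, where [frob t] acts trivially, settles both. *)

Fixpoint orbit_from (fuel t v r x : nat) : seq nat :=
  if fuel is fuel'.+1 then
    if x == r then [::] else x :: orbit_from fuel' t v r (x * t %% v)
  else [::].

Definition orbit_of (t v r : nat) : seq nat :=
  r :: orbit_from v t v r (r * t %% v).

Definition orbits (t v : nat) : seq (seq nat) :=
  rev (foldl (fun os k => if has (fun o => k \in o) os then os
                          else orbit_of t v k :: os) [::] (iota 0 v)).

(** For w dividing v an orbit of Z/v lies over a single orbit of Z/w, so its head decides the
    group. *)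
Definition groups (t v w : nat) : seq (seq (seq nat)) :=
  let os := orbits t v in
  [seq [seq o <- os | head 0 o %% w \in ow] | ow <- orbits (t %% w) w].

Definition is_orbit (t v : nat) (o : seq nat) : bool :=
  if o is r :: o' then path (fun x y => y == x * t %% v) r o' else false.

(** The orbit computation is not proved correct. Each search checks by evaluation that its output
    consists of trajectories of t and covers 0, ..., v - 1 with exactly v entries, which is all that
    the soundness proof uses. *)
Definition groups_ok (t v w : nat) : bool :=
  let os := flatten (groups t v w) in
  let ks := flatten os in
  [&& all (is_orbit t v) os, size ks == v & all (fun k => k \in ks) (iota 0 v)].

(** Without trailing zeros, [step] can test an equation as soon as its last variable with a nonzero
    coefficient is assigned. *)
Fixpoint trim (cs : seq Z) : seq Z :=
  if cs is c :: cs' then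
    let cs1 := trim cs' in
    if cs1 is [::] then if Z.eqb c 0 then [::] else [:: c] else c :: cs1
  else [::].

Definition coefs (w j : nat) (g : seq (seq nat)) : seq Z :=
  [seq Z.of_nat (count (fun k => k %% w == j) o) | o <- g].

(** A group receives the equation of a residue j only if it contains all positions over j. One j per
    orbit is taken, as the images are constant on orbits too. *)
Definition group_eqs (t v : nat) (ws : seq nat) (g : seq (seq nat)) :
    seq (nat * nat * seq Z) :=
  let ks := flatten g in
  flatten [seq [seq (i, j, trim (coefs (nth 0 ws i) j g))
               | j <- [seq head 0 o | o <- orbits (t %% nth 0 ws i) (nth 0 ws i)]
               & count (fun k => k %% nth 0 ws i == j) ks == v %/ nth 0 ws i]
          | i <- iota 0 (size ws)].

Definition plan (t v w : nat) (ws : seq nat) :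
    seq (seq (Z * nat) * seq (nat * nat * seq Z)) :=
  [seq ([seq (Z.of_nat (size o), head 0 o) | o <- g], group_eqs t v ws g)
  | g <- groups t v w].

(** The orbits are reversed because [options] and [combine] push the chosen values onto the front of
    an accumulator. *)
Definition index_table (t v w : nat) : seq nat :=
  let os := rev (flatten (groups t v w)) in
  [seq find (fun o => k \in o) os | k <- iota 0 v].

Section Search.
Local Open Scope Z_scope.

Fixpoint step (x : Z) (es : seq (Z * seq Z)) : option (seq (Z * seq Z)) :=
  match es with
  | [::] => Some [::]
  | (r, [::]) :: es' => if Z.eqb r 0 then step x es' else None
  | (r, c :: cs) :: es' =>
    let r' := r - c * x in
    match cs with
    | [::] => if Z.eqb r' 0 then step x es' else None
    | _ :: _ => if step x es' is Some es1 then Some ((r', cs) :: es1) else None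
    end
  end.

Fixpoint options (n : Z) (dom : nat -> seq Z) (lev : seq (Z * nat))
    (es : seq (Z * seq Z)) (q : Z) (acc : seq Z) : seq (Z * seq Z) :=
  match lev with
  | [::] => [:: (q, acc)]
  | (sz, r) :: lev' =>
    flatten [seq (let q' := q + sz * (x * x) in
                  if Z.leb q' n then
                    if step x es is Some es' then options n dom lev' es' q' (x :: acc)
                    else [::]
                  else [::])
            | x <- dom r]
  end.

Fixpoint dot (a b : seq Z) : Z :=
  match a, b with
  | x :: a', y :: b' => x * y + dot a' b'
  | _, _ => 0
  end.

(** [cur] runs through suffixes of l ++ l and [dot] stops at the end of l, so each product is a
    cyclic correlation. Shift 0 is left to the norm count in [combine]. *)
Fixpoint corr_ok (l cur T : seq Z) : bool :=
  if T is a :: T' then if Z.eqb (dot l cur) a then corr_ok l (behead cur) T' else false else true.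

Fixpoint combine (idx : seq nat) (T : seq Z) (os : seq (seq (Z * seq Z)))
    (q : Z) (acc : seq Z) : seq (seq Z) :=
  match os with
  | [::] =>
    if Z.eqb q 0 then
      let l := [seq nth 0 acc i | i <- idx] in
      if corr_ok l (behead (l ++ l)) (behead T) then [:: l] else [::]
    else [::]
  | o :: os' =>
    flatten [seq (let q' := q - qv.1 in
                  if Z.leb 0 q' then combine idx T os' q' (qv.2 ++ acc) else [::])
            | qv <- o]
  end.

(** [solve1] takes these minima off the budget in advance, so the nonnegativity test in [combine]
    already reserves what the remaining groups must spend. *)
Definition min_norm (n : Z) (o : seq (Z * seq Z)) : Z :=
  foldr (fun qv m => Z.min qv.1 m) n o.

Definition solve1 (pl : seq (seq (Z * nat) * seq (nat * nat * seq Z)))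
    (idx : seq nat) (T : seq Z) (dom : nat -> seq Z) (Bs : seq (seq Z)) :
    seq (seq Z) :=
  let n := head 0 T in
  let os := [seq options n dom le.1
                  [seq (nth 0 (nth [::] Bs e.1.1) e.1.2, e.2) | e <- le.2] 0 [::]
            | le <- pl] in
  combine idx T
    [seq (let m := min_norm n o in [seq (qv.1 - m, qv.2) | qv <- o]) | o <- os]
    (foldl (fun q o => q - min_norm n o) n os) [::].

(* The sequences of length [v], constant on the orbits of [t], with cyclic
   autocorrelation [T], such that for an [item] the entry [k] lies in
   [item.1 k] and the image modulo [nth 0 ws i] is [nth [::] item.2 i]. The
   orbits are grouped by their image modulo [w]: the options of a group are
   filtered by the image equations before the groups are combined under the
   norm bound [head 0 T]. *)
Definition solve (t v w : nat) (ws : seq nat) (T : seq Z)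
    (items : seq ((nat -> seq Z) * seq (seq Z))) : seq (seq Z) :=
  let pl := plan t v w ws in
  let idx := index_table t v w in
  flatten [seq solve1 pl idx T item.1 item.2 | item <- items].

Definition range (b : nat) (_ : nat) : seq Z :=
  [seq Z.of_nat k - Z.of_nat b | k <- iota 0 b.*2.+1].

Definition single (v : nat) (n : Z) : seq Z := n :: nseq v.-1 0.

(* The autocorrelation of A(1 - [v/2]) when that of A is [n]; see [nth_anti]. *)
Definition anti (v : nat) (n : Z) : seq Z :=
  [seq if k == 0%N then 2 * n else if k == v./2 then - (2 * n) else 0 | k <- iota 0 v].

End Search.

Section Searches.
Local Open Scope Z_scope.

(** Ranges here and below are a coefficient bound times a coset size: images of order 140 have
    coefficients at most 4 in Z[C_35], hence at most 20 in Z[C_7]. The augmentation is a square root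
    of 36. *)
Definition icw7 : seq (seq Z) :=
  solve 4 7 1 [:: 1%N] (single 7 36) [seq (range 20, [:: [:: a]]) | a <- [:: 6; -6]].
Definition icw35 : seq (seq Z) :=
  solve 4 35 7 [:: 7%N] (single 35 36) [seq (range 4, [:: x]) | x <- icw7].

Lemma icw35_values :
  all (all (fun a => [|| Z.eqb a 0, Z.eqb a 3 | Z.eqb a (-3)])) icw35.
Proof. by vm_compute. Qed.

(** This is n (3 - N) for the sum N of the subgroup of order 3. It is used with n = 12 for C = A (3
    - N) / 3, where A has weight 36: since N^2 = 3 N, the correlation of C is 36 (3 - N)^2 / 9 = 12
    (3 - N). *)
Definition corr3 (v : nat) (n : Z) : seq Z :=
  [seq if k == 0%N then 2 * n
       else if (k == v %/ 3)%N || (k == 2 * (v %/ 3))%N then - n else 0 | k <- iota 0 v].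
Definition cw105_15 : seq (seq Z) :=
  solve 4 15 5 [:: 5%N] (corr3 15 12) [seq (range 7, [:: x]) | x <- [:: nseq 5 0]].
Definition cw105 : seq (seq Z) :=
  solve 4 105 5 [:: 35%N; 15%N] (corr3 105 12)
    [seq (range 1, [:: nseq 35 0; x]) | x <- cw105_15].

Lemma cw105_nil : cw105 = [::].
Proof. by vm_compute. Qed.

(* From here [anti] marks elements A(1 - [v/2]), whose image modulo v/2 is 0. *)
Definition icw20 : seq (seq Z) :=
  solve 37 20 10 [:: 10%N] (anti 20 64) [seq (range 14, [:: x]) | x <- [:: nseq 10 0]].
Definition cw140 : seq (seq Z) :=
  solve 37 140 10 [:: 70%N; 20%N] (anti 140 64)
    [seq (range 2, [:: nseq 70 0; x]) | x <- icw20].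

Lemma cw140_nil : cw140 = [::].
Proof. by vm_compute. Qed.

Definition icw12 : seq (seq Z) :=
  solve 137 12 6 [:: 6%N] (anti 12 64) [seq (range 30, [:: x]) | x <- [:: nseq 6 0]].
Definition icw36 : seq (seq Z) :=
  solve 137 36 6 [:: 18%N; 12%N] (anti 36 64)
    [seq (range 10, [:: nseq 18 0; x]) | x <- icw12].
Definition cw180 : seq (seq Z) :=
  solve 137 180 18 [:: 90%N; 36%N] (anti 180 64)
    [seq (range 2, [:: nseq 90 0; x]) | x <- icw36].

Lemma cw180_nil : cw180 = [::].
Proof. by vm_compute. Qed.

Definition icw28 : seq (seq Z) :=
  solve 149 28 14 [:: 14%N] (anti 28 64) [seq (range 14, [:: x]) | x <- [:: nseq 14 0]].
Definition cw196 : seq (seq Z) :=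
  solve 149 196 14 [:: 98%N; 28%N] (anti 196 64)
    [seq (range 2, [:: nseq 98 0; x]) | x <- icw28].

Lemma cw196_nil : cw196 = [::].
Proof. by vm_compute. Qed.

Definition icw29 : seq (seq Z) :=
  solve 7 29 1 [:: 1%N] (single 29 49) [seq (range 4, [:: x]) | x <- [:: [:: 7]]].
Definition icw58 : seq (seq Z) :=
  solve 7 58 29 [:: 29%N] (single 58 49) [seq (range 2, [:: x]) | x <- icw29].
Definition cw116 : seq (seq Z) :=
  solve 7 116 58 [:: 58%N] (single 116 49) [seq (range 1, [:: x]) | x <- icw58].

Lemma cw116_nil : cw116 = [::].
Proof. by vm_compute. Qed.

Definition icw3 : seq (seq Z) :=
  solve 7 3 1 [:: 1%N] (single 3 49) [seq (range 40, [:: x]) | x <- [:: [:: 7]]].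
Definition icw15 : seq (seq Z) :=
  solve 7 15 3 [:: 3%N] (single 15 49) [seq (range 8, [:: x]) | x <- icw3].
Definition icw30 : seq (seq Z) :=
  solve 7 30 15 [:: 15%N] (single 30 49) [seq (range 4, [:: x]) | x <- icw15].
(** Order 60 is already impossible, so order 120 itself is never searched. *)
Definition icw60 : seq (seq Z) :=
  solve 7 60 30 [:: 30%N] (single 60 49) [seq (range 2, [:: x]) | x <- icw30].

Lemma icw60_nil : icw60 = [::].
Proof. by vm_compute. Qed.

(* Order 192: let b be the coefficients of A and s those of its image in C_96.
   As 49 = 1 modulo 48, the elements A(1 - [96]) and its analogue in C_96 vanish
   off the multiples of 4 and of 2; restricting them to these multiples gives
   F z = b(4z) - b(4z + 96) and G z = s(2z) - s(2z + 48), both on Z/48. *)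
Definition icw16 : seq (seq Z) :=
  solve 7 16 8 [:: 8%N] (anti 16 49) [seq (range 6, [:: x]) | x <- [:: nseq 8 0]].
Definition icw48 : seq (seq Z) :=
  solve 7 48 8 [:: 16%N; 24%N] (anti 48 49)
    [seq (range 2, [:: x; nseq 24 0]) | x <- icw16].

(** For odd z both s(2z) and s(2z + 48) are twice a coefficient of A, so G is even at odd
    positions. *)
Definition even_range (b k : nat) : seq Z :=
  if odd k then [seq 2 * x | x <- range b./2 k] else range b k.
Definition icw16e : seq (seq Z) :=
  solve 7 16 8 [:: 8%N] (anti 16 49) [seq (even_range 12, [:: x]) | x <- [:: nseq 8 0]].
Definition icw48e : seq (seq Z) :=
  solve 7 48 8 [:: 16%N; 24%N] (anti 48 49)
    [seq (even_range 4, [:: x; nseq 24 0]) | x <- icw16e].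

(* The possible sums x + y of x, y in {-1, 0, 1} with x - y = f. *)
Definition sums (f : Z) : seq Z :=
  if Z.eqb f 0 then [:: -2; 0; 2] else if Z.even f then [:: 0] else [:: -1; 1].

(* The values that F and G leave for s(k) + s(k + 48), the image of A in C_48. *)
Definition dom48 (F G : seq Z) (k : nat) : seq Z :=
  if odd k then [:: -4; 0; 4] else
  let m := k./2 in
  let g := nth 0 G m in
  let f := if odd m then 0 else nth 0 F m./2 in
  let f' := if odd m then 0 else nth 0 F (m./2 + 12)%N in
  [seq 2 * a - g | a <- sums f & has (Z.eqb (a - g)) (sums f')].

(** Only even positions are tested: at odd ones the domain does not depend on F and G. *)
Fixpoint compatible (F G : seq Z) (m : nat) : bool :=
  if m is m'.+1 then
    if dom48 F G m'.*2 is [::] then false else compatible F G m'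
  else true.

Definition pairs192 : seq (seq Z * seq Z) :=
  flatten [seq [seq (F, G) | G <- icw48e & compatible F G 24] | F <- icw48].
(** With w = v every orbit is its own group; the domains take over the role of the image
    equations. *)
Definition cw192 : seq (seq Z) :=
  solve 7 48 48 [::] (single 48 49) [seq (dom48 FG.1 FG.2, [::]) | FG <- pairs192].

Lemma cw192_nil : cw192 = [::].
Proof. by vm_compute. Qed.

End Searches.

Local Open Scope ring_scope.

(** * Frobenius-stable ideals *)

Section FrobeniusIdeals.

Variables (S : comNzRingType) (phi : {rmorphism S -> S}) (p : nat) (a c : S).

(* Divisibility by [a ^+ m] after multiplication by [c]; the multiplier [c]
   annihilates the characters that are left out, and is 1 in the absolute case. *)
Definition dvc (m : nat) (x : S) : Prop := exists y, x * c = a ^+ m * y * c.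

Lemma dvc0 x : dvc 0 x.
Proof. by exists x; rewrite expr0 mul1r. Qed.

Lemma dvcD m x y : dvc m x -> dvc m y -> dvc m (x + y).
Proof. by move=> [u hu] [w hw]; exists (u + w); rewrite mulrDl hu hw; ring. Qed.

Lemma dvcN m x : dvc m x -> dvc m (- x).
Proof. by move=> [u hu]; exists (- u); rewrite mulNr hu; ring. Qed.

Lemma dvcM k m x y : dvc k x -> dvc m y -> dvc (k + m) (x * y).
Proof.
move=> [u hu] [w hw]; exists (u * w).
rewrite -mulrA hw (_ : x * _ = x * c * (a ^+ m * w)); last by ring.
by rewrite hu exprD; ring.
Qed.

Lemma dvcMl m x y : dvc m x -> dvc m (y * x).
Proof. by move=> hx; rewrite -[m]add0n; apply: dvcM => //; apply: dvc0. Qed.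

Lemma dvcMr m x y : dvc m x -> dvc m (x * y).
Proof. by rewrite mulrC; apply: dvcMl. Qed.

Definition eqc (m : nat) (x y : S) : Prop := dvc m (x - y).

Lemma eqcc m x : eqc m x x.
Proof. by exists 0; rewrite subrr; ring. Qed.

Lemma eqc_sym m x y : eqc m x y -> eqc m y x.
Proof. by rewrite /eqc -(opprB x y); apply: dvcN. Qed.

Lemma eqc_trans m y x z : eqc m x y -> eqc m y z -> eqc m x z.
Proof.
by move=> h1 h2; rewrite /eqc (_ : x - z = (x - y) + (y - z)); [apply: dvcD | ring].
Qed.

Lemma eqcM m x y u w : eqc m x y -> eqc m u w -> eqc m (x * u) (y * w).
Proof.
move=> h1 h2; rewrite /eqc (_ : _ - _ = (x - y) * u + y * (u - w)); last by ring.
by apply: dvcD; [apply: dvcMr | apply: dvcMl].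
Qed.

Lemma eqcX m x y k : eqc m x y -> eqc m (x ^+ k) (y ^+ k).
Proof.
move=> h; elim: k => [|k IH]; first by rewrite !expr0; apply: eqcc.
by rewrite !exprS; apply: eqcM.
Qed.

Hypothesis p_a : dvc 1 p%:R.
Hypothesis phi_a : phi a = a.
Hypothesis phi_c : phi c = c.
Hypothesis phi_p : forall x, eqc 1 (phi x) (x ^+ p).
Variable f : nat.
Hypothesis f_gt0 : (0 < f)%N.
Hypothesis p_gt1 : (1 < p)%N.
Hypothesis phi_f : forall x, iter f phi x = x.

(** In x^p - y^p = (x - y) (...) the second factor is congruent to p y^(p-1) modulo [a], and p is
    itself divisible by [a]; this supplies the additional factor. *)
Lemma eqcXp m x y : eqc m.+1 x y -> eqc m.+2 (x ^+ p) (y ^+ p).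
Proof.
move=> h; rewrite /eqc subrXX -addn1; apply: dvcM => //.
have h1 : eqc 1 x y.
  case: h => z hz; exists (a ^+ m * z); rewrite hz exprS expr1; ring.
have -> : \sum_(i < p) x ^+ (p.-1 - i) * y ^+ i =
   \sum_(i < p) (x ^+ (p.-1 - i) * y ^+ i - y ^+ p.-1) + p%:R * y ^+ p.-1.
  by rewrite sumrB sumr_const card_ord mulr_natl subrK.
apply: dvcD; last by apply: dvcMr.
elim/big_ind: _ => [|u w|i _]; [|exact: dvcD|].
  by rewrite -(subrr c); apply: eqcc.
have -> : y ^+ p.-1 = y ^+ (p.-1 - i) * y ^+ i.
  by rewrite -exprD subnK //; have := ltn_ord i; lia.
by apply: eqcM; [apply: eqcX | apply: eqcc].
Qed.

Lemma eqcXpn m x y : eqc 1 x y -> eqc m.+1 (x ^+ (p ^ m)) (y ^+ (p ^ m)).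
Proof.
move=> h; elim: m => [|m IH]; first by rewrite expn0 !expr1.
by rewrite expnSr !exprM; apply: eqcXp.
Qed.

Lemma eqc_phi m x y : eqc m x y -> eqc m (phi x) (phi y).
Proof.
move=> [z hz]; exists (phi z).
by rewrite -rmorphB -{1}phi_c -rmorphM hz !rmorphM rmorphXn /= phi_a phi_c.
Qed.

Lemma eqc_iter_phi k x : eqc 1 (iter k phi x) (x ^+ (p ^ k)).
Proof.
elim: k => [|k IH]; first by rewrite expn0 expr1; apply: eqcc.
rewrite iterS; apply: (eqc_trans (y := phi (x ^+ (p ^ k)))); first exact: eqc_phi.
by rewrite expnSr exprM; apply: phi_p.
Qed.

(* In the unramified situation every ideal is stable under the Frobenius map:
   modulo [a] the power [w] of [x] is an idempotent fixed by [phi], and its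
   [p]-power lifts split off the part of [x] that is divisible by [a]. *)
Lemma frobenius_ideal m x : exists s, eqc m (phi x) (x * s).
Proof.
elim: m x => [|m IH] x; first by exists 0; apply: dvc0.
(* The exponent k + 1 = p^f - 1 is positive, and x^(p^f) is congruent to x because [phi] has order
   dividing f; hence w is idempotent modulo [a]. *)
have [k pfE] : exists k, (p ^ f = k.+2)%N.
  exists (p ^ f - 2)%N; have := leq_pexp2l (ltnW p_gt1) f_gt0; rewrite expn1; lia.
pose w := x ^+ k.+1; pose E := w ^+ (p ^ m).
have xw : eqc 1 (w * x) x.
  rewrite /w -exprSr -pfE; apply: eqc_sym; rewrite -{1}(phi_f x).
  exact: eqc_iter_phi.
have ww : eqc 1 (w * w) w.
  rewrite {2}/w exprS mulrA /w [X in eqc _ _ X]exprS.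
  by apply: eqcM => //; apply: eqcc.
have wX j : eqc 1 (w ^+ j.+1) w.
  elim: j => [|j IHj]; first by rewrite expr1; apply: eqcc.
  rewrite exprS; apply: eqc_trans ww; apply: eqcM => //; exact: eqcc.
have phiw : eqc 1 (phi w) w.
  apply: eqc_trans (phi_p w) _.
  by case: (p) p_gt1 => // q _; apply: wX.
have phiE : eqc m.+1 (phi E) E by rewrite /E rmorphXn; apply: eqcXpn.
have Ew : eqc 1 E w.
  by rewrite /E; case: (p ^ m)%N (expn_gt0 p m) => [|q _]; [lia | apply: wX].
have [x1 hx1] : dvc 1 ((1 - E) * x).
  rewrite (_ : (1 - E) * x = (x - w * x) + (w - E) * x); last by ring.
  apply: dvcD; first exact/eqc_sym.
  by apply: dvcMr; apply/eqc_sym.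
have [s [d hd]] := IH x1.
have [e hE] : exists e, E = x * e.
  exists (x ^+ (k.+1 * p ^ m).-1).
  rewrite -exprS prednK ?/E ?/w ?exprM //.
  by rewrite muln_gt0 expn_gt0; lia.
(* On the part cut out by E, the multiple x e = E makes e * phi x work. On the complement (1 - E) x
   is [a] times x1, and s comes from the induction hypothesis for x1. *)
exists (e * phi x + (1 - E) * s).
rewrite /eqc (_ : _ - _ = (phi E - E) * phi x + (phi ((1 - E) * x) - (1 - E) * x * s)).
  apply: dvcD; first exact: dvcMr.
  exists d; have hphi : phi ((1 - E) * x) * c = a * phi x1 * c.
    by rewrite -{1}phi_c -rmorphM hx1 !rmorphM rmorphXn /= phi_a phi_c expr1.
  have -> : (phi ((1 - E) * x) - (1 - E) * x * s) * c = a * ((phi x1 - x1 * s) * c).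
    rewrite mulrBl hphi [_ * x * s]mulrC -[s * _ * c]mulrA hx1 expr1; ring.
  by rewrite hd exprS; ring.
by rewrite rmorphM rmorphB rmorph1 hE; ring.
Qed.

Lemma frobenius_iter_ideal j m x : exists s, eqc m (iter j phi x) (x * s).
Proof.
elim: j => [|j [s hs]]; first by exists 1; rewrite mulr1; apply: eqcc.
have [s1 hs1] := frobenius_ideal m x.
exists (s1 * phi s); rewrite iterS; apply: eqc_trans (eqc_phi hs) _.
by rewrite rmorphM mulrA; apply: eqcM => //; apply: eqcc.
Qed.

End FrobeniusIdeals.

(** * Group rings and multipliers *)

(** A separate name for the function type, since its product is to be convolution. *)
Definition gring (G : finZmodType) : Type := {ffun G -> int}.

Section GroupRing.
Variable G : finZmodType.

HB.instance Definition _ := GRing.Zmodule.copy (gring G) {ffun G -> int}.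

Lemma gringP (f g : gring G) : (forall k, f k = g k) -> f = g.
Proof. by move=> h; apply/(@ffunP G (fun _ => int) f g). Qed.

Definition gone : gring G := [ffun k => (k == 0)%:R].
Definition gmul (f g : gring G) : gring G := [ffun k => \sum_i f i * g (k - i)].

Lemma gmulE f g k : gmul f g k = \sum_i f i * g (k - i).
Proof. by rewrite ffunE. Qed.

Lemma gaddE (f g : gring G) k : (f + g) k = f k + g k.
Proof. by rewrite ffunE. Qed.

Lemma goneE k : gone k = (k == 0)%:R.
Proof. by rewrite ffunE. Qed.

Fact gmulC : commutative gmul.
Proof.
move=> f g; apply: gringP => k; rewrite !gmulE (reindex_inj (subrI k)) /=.
by apply: eq_bigr => i _; rewrite mulrC subKr.
Qed.

Fact gmulA : associative gmul.
Proof.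
move=> f g h; apply: gringP => k; rewrite !gmulE.
under eq_bigr => i _ do rewrite gmulE big_distrr /=.
under [RHS]eq_bigr => i _ do rewrite gmulE big_distrl /=.
rewrite [RHS]exchange_big /=; apply: eq_bigr => i _.
rewrite [RHS](reindex_inj (addrI i)) /=; apply: eq_bigr => j _.
by rewrite mulrA [i + j]addrC addrK opprD addrA addrAC.
Qed.

Fact gmul1 : left_id gone gmul.
Proof.
move=> f; apply: gringP => k; rewrite gmulE (bigD1 0) //= goneE eqxx mul1r subr0.
by rewrite big1 ?addr0 // => i /negbTE hi; rewrite goneE hi mul0r.
Qed.

Fact gmulDl : left_distributive gmul +%R.
Proof.
move=> f g h; apply: gringP => k; rewrite gaddE !gmulE -big_split /=.
by apply: eq_bigr => i _; rewrite gaddE mulrDl.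
Qed.

Fact gone_neq0 : gone != 0.
Proof. by apply/eqP => /(congr1 (fun f : gring G => f 0)); rewrite goneE eqxx ffunE. Qed.

HB.instance Definition _ := GRing.Zmodule_isComNzRing.Build (gring G)
  gmulA gmulC gmul1 gmulDl gone_neq0.

Definition gsingle (g : G) : gring G := [ffun k => (k == g)%:R].

Lemma gsingleE g k : gsingle g k = (k == g)%:R.
Proof. by rewrite ffunE. Qed.

Lemma gringM (f g : gring G) k : (f * g) k = \sum_i f i * g (k - i).
Proof. exact: gmulE. Qed.

Lemma gring0 k : (0 : gring G) k = 0.
Proof. by rewrite ffunE. Qed.

Lemma gringN (f : gring G) k : (- f) k = - f k.
Proof. by rewrite ffunE. Qed.

Lemma gringMz (f : gring G) (z : int) k : (f *~ z) k = f k *~ z.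
Proof.
have hn n : (f *+ n) k = f k *+ n.
  by elim: n => [|n IH]; rewrite ?mulr0n ?gring0 // !mulrS gaddE IH.
by case: z => n; rewrite ?NegzE ?mulrNz ?gringN -?pmulrn hn.
Qed.

Lemma gringMn (f : gring G) n k : (f *+ n) k = f k *+ n.
Proof. by rewrite pmulrn gringMz -pmulrn. Qed.

Lemma gring_sum (I : Type) (r : seq I) (P : pred I) (F : I -> gring G) k :
  (\sum_(i <- r | P i) F i) k = \sum_(i <- r | P i) F i k.
Proof.
by elim/big_rec2: _ => [|i x y _ <-]; rewrite ?gring0 ?gaddE.
Qed.

Lemma gringE (f : gring G) : f = \sum_g gsingle g *~ f g.
Proof.
apply: gringP => k; rewrite gring_sum (bigD1 k) //= gringMz gsingleE eqxx.
rewrite big1 ?addr0 ?intz // => i /negbTE hi.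
by rewrite gringMz gsingleE eq_sym hi mul0rz.
Qed.

Lemma gsingleMl g (f : gring G) k : (gsingle g * f) k = f (k - g).
Proof.
rewrite gringM (bigD1 g) //= gsingleE eqxx mul1r big1 ?addr0 // => i /negbTE hi.
by rewrite gsingleE hi mul0r.
Qed.

Lemma gsingleM g h : gsingle g * gsingle h = gsingle (g + h).
Proof. by apply: gringP => k; rewrite gsingleMl !gsingleE subr_eq addrC. Qed.

Lemma gsingle0 : gsingle 0 = 1.
Proof. by []. Qed.

Lemma gsingleX g n : gsingle g ^+ n = gsingle (g *+ n).
Proof. by elim: n => [|n IH]; rewrite ?expr0 // exprS IH gsingleM mulrS. Qed.

Lemma gring_ind (P : gring G -> Prop) :
  P 0 -> (forall f g, P f -> P (f + gsingle g)) ->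
  (forall f g, P f -> P (f - gsingle g)) -> forall f, P f.
Proof.
move=> h0 hD hB f; rewrite [f]gringE.
elim: (index_enum G) => [|g r IH]; first by rewrite big_nil.
rewrite big_cons addrC; move: IH; set x := \sum_(i <- r) _ => hx.
have hn n : P (x + gsingle g *~ n%:Z) /\ P (x - gsingle g *~ n%:Z).
  elim: n => [|n [IH1 IH2]]; first by rewrite mulr0z subr0 addr0.
  by rewrite intS mulrzDr mulr1z addrCA addrC opprD addrCA addrC; split;
    [rewrite addrC; exact: hD | rewrite [_ + (x - _)]addrC; exact: hB].
by case: (f g) => n; [have [] := hn n | rewrite NegzE mulrNz; have [] := hn n.+1].
Qed.

End GroupRing.

Section Push.
Variables G H : finZmodType.

Definition push (psi : G -> H) (f : gring G) : gring H :=
  [ffun h => \sum_(g | psi g == h) f g].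

Lemma pushE psi f h : push psi f h = \sum_(g | psi g == h) f g.
Proof. by rewrite ffunE. Qed.

Fact push_zmod psi : zmod_morphism (push psi).
Proof.
move=> f g; apply: gringP => h; rewrite gaddE gringN !pushE -sumrB.
by apply: eq_bigr => i _; rewrite gaddE gringN.
Qed.
HB.instance Definition _ psi :=
  GRing.isZmodMorphism.Build (gring G) (gring H) (push psi) (push_zmod psi).

Lemma push_single psi g : push psi (gsingle g) = gsingle (psi g).
Proof.
apply: gringP => h; rewrite pushE gsingleE; case: eqP => [->|ne].
  rewrite (bigD1 g) //= gsingleE eqxx big1 ?addr0 // => i /andP[_ /negbTE hi].
  by rewrite gsingleE hi.
rewrite big1 // => i /eqP hi; rewrite gsingleE; case: eqP => // hig.
by case: ne; rewrite -hi hig.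
Qed.

Lemma pushM psi f g : {morph psi : x y / x + y} ->
  push psi (f * g) = push psi f * push psi g.
Proof.
move=> hpsi; elim/gring_ind: f => [|f a IH|f a IH]; first by rewrite mul0r !raddf0 mul0r.
  rewrite mulrDl !raddfD /= mulrDl IH; congr (_ + _).
  elim/gring_ind: g {IH} => [|g b IH|g b IH]; first by rewrite mulr0 !raddf0 mulr0.
    by rewrite mulrDr !raddfD /= IH mulrDr gsingleM !push_single gsingleM hpsi.
  by rewrite mulrBr !raddfB /= IH mulrBr gsingleM !push_single gsingleM hpsi.
rewrite mulrBl !raddfB /= mulrBl IH; congr (_ - _).
elim/gring_ind: g {IH} => [|g b IH|g b IH]; first by rewrite mulr0 !raddf0 mulr0.
  by rewrite mulrDr !raddfD /= IH mulrDr gsingleM !push_single gsingleM hpsi.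
by rewrite mulrBr !raddfB /= IH mulrBr gsingleM !push_single gsingleM hpsi.
Qed.

Lemma push1 psi : psi 0 = 0 -> push psi 1 = 1.
Proof. by move=> h; rewrite -gsingle0 push_single h gsingle0. Qed.

Lemma push_inj psi f g : injective psi -> push psi f (psi g) = f g.
Proof.
move=> hi; rewrite pushE (bigD1 g) //= big1 ?addr0 // => i /andP[/eqP /hi -> ].
by rewrite eqxx.
Qed.

End Push.

Lemma push_comp (G H K : finZmodType) (chi : G -> H) (psi : H -> K) f :
  push psi (push chi f) = push (psi \o chi) f.
Proof.
elim/gring_ind: f => [|f a IH|f a IH]; first by rewrite !raddf0.
  by rewrite !raddfD /= IH !push_single.
by rewrite !raddfB /= IH !push_single.
Qed.

Lemma eq_push (G H : finZmodType) (psi chi : G -> H) f :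
  psi =1 chi -> push psi f = push chi f.
Proof.
by move=> h; apply: gringP => k; rewrite !pushE; apply: eq_bigl => g; rewrite h.
Qed.

Lemma push_id (G : finZmodType) (psi : G -> G) f : psi =1 id -> push psi f = f.
Proof.
move=> h; apply: gringP => k; rewrite pushE (big_pred1 k) // => g.
by rewrite h.
Qed.

Section Star.
Variable G : finZmodType.

Definition star (f : gring G) : gring G := push -%R f.
HB.instance Definition _ := GRing.Additive.copy star (push -%R).

Lemma starE f k : star f k = f (- k).
Proof. by rewrite -[in LHS](opprK k) /star push_inj //; apply: oppr_inj. Qed.

Fact star_multiplicative : monoid_morphism star.
Proof.
split; first by apply: push1; rewrite oppr0.
by move=> f g; apply: pushM => x y; rewrite opprD.
Qed.
HB.instance Definition _ :=
  GRing.isMonoidMorphism.Build (gring G) (gring G) star star_multiplicative.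

Lemma star_single g : star (gsingle g) = gsingle (- g).
Proof. exact: push_single. Qed.

Lemma starK f : star (star f) = f.
Proof. by apply: gringP => k; rewrite !starE opprK. Qed.

Lemma corrE f k : (f * star f) k = \sum_g f g * f (g - k).
Proof. by rewrite gringM; apply: eq_bigr => g _; rewrite starE opprB. Qed.

Lemma corr0E f : (f * star f) 0 = \sum_g f g ^+ 2.
Proof. by rewrite corrE; apply: eq_bigr => g _; rewrite subr0. Qed.

Lemma corr_single g f : (gsingle g * f) * star (gsingle g * f) = f * star f.
Proof.
by rewrite rmorphM /= mulrACA star_single gsingleM subrr gsingle0 mul1r.
Qed.

End Star.

Lemma push_star (G H : finZmodType) (psi : G -> H) f :
  {morph psi : x / - x} -> push psi (star f) = star (push psi f).
Proof. by move=> h; rewrite /star !push_comp; apply: eq_push => x /=; rewrite h. Qed.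

Section Frobenius.
Variable G : finZmodType.

Definition frob (t : nat) (f : gring G) : gring G := push (fun k => k *+ t) f.
HB.instance Definition _ t := GRing.Additive.copy (frob t) (push (fun k => k *+ t)).

Fact frob_multiplicative t : monoid_morphism (frob t).
Proof.
split; first by apply: push1; rewrite mul0rn.
by move=> f g; apply: pushM => x y; rewrite mulrnDl.
Qed.
HB.instance Definition _ t :=
  GRing.isMonoidMorphism.Build (gring G) (gring G) (frob t) (frob_multiplicative t).

Lemma frob_single t g : frob t (gsingle g) = gsingle (g *+ t).
Proof. exact: push_single. Qed.

Lemma frob_star t f : frob t (star f) = star (frob t f).
Proof. by apply: push_star => x; rewrite mulNrn. Qed.

Lemma iter_frob t j f : iter j (frob t) f = frob (t ^ j) f.
Proof.
elim: j => [|j IH]; first by rewrite /frob push_id // => x; rewrite expn0 mulr1n.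
by rewrite iterS IH /frob push_comp; apply: eq_push => x /=; rewrite -mulrnA expnSr.
Qed.

Lemma exprD_prime (S : comNzRingType) p (x y : S) :
  prime p -> exists z, (x + y) ^+ p = x ^+ p + y ^+ p + p%:R * z.
Proof.
move=> pp; case: p pp => // q pp; rewrite exprDn big_ord_recl big_ord_recr /=.
rewrite subn0 expr0 mulr1 bin0 mulr1n subnn expr0 mul1r binn mulr1n.
exists (\sum_(i < q) x ^+ (q.+1 - i.+1) * y ^+ i.+1 *+ ('C(q.+1, i.+1) %/ q.+1)).
rewrite -addrA [y ^+ _ + _]addrC; congr (_ + (_ + _)).
rewrite mulr_sumr; apply: eq_bigr => i _; rewrite mulr_natl -mulrnA divnK //.
by apply: prime_dvd_bin => //=; have := ltn_ord i; lia.
Qed.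

(** The binomial formula modulo p, adding or removing one group element at a time. *)
Lemma frob_prime p f : prime p -> exists z, f ^+ p = frob p f + p%:R * z.
Proof.
move=> pp; elim/gring_ind: f => [|f g [z hz]|f g [z hz]].
- by exists 0; rewrite raddf0 expr0n; case: p pp => // p _; rewrite mulr0 addr0.
- have [w hw] := exprD_prime f (gsingle g) pp.
  by exists (z + w); rewrite hw hz gsingleX raddfD /= frob_single; ring.
- have [w hw] := exprD_prime (f - gsingle g) (gsingle g) pp.
  exists (z - w); rewrite raddfB /= frob_single mulrBr addrACA -hz.
  by rewrite -gsingleX -{2}(subrK (gsingle g) f) hw; ring.
Qed.

End Frobenius.

Lemma sqr_sum1 (I : finType) (x : I -> int) :
  \sum_i x i ^+ 2 = 1 -> exists i, (x i = 1 \/ x i = -1) /\ forall j, j != i -> x j = 0.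
Proof.
move=> h; have [i hi] : exists i, x i != 0.
  apply/existsP; rewrite -negb_forall; apply/negP => /forallP h0.
  by move: h; rewrite big1 // => i _; move/eqP: (h0 i) ->.
have hs : \sum_(j | j != i) x j ^+ 2 = 0.
  apply/eqP; rewrite eq_le sumr_ge0 ?andbT => [|j _]; last exact: sqr_ge0.
  move: h; rewrite (bigD1 i) //=; set s := \sum_(j | _) _ => h; nia.
exists i; split; first by move: h; rewrite (bigD1 i) //= hs; nia.
move=> j hj; move/eqP: hs; rewrite psumr_eq0 => [/allP /(_ j)|k _]; last exact: sqr_ge0.
by rewrite mem_index_enum hj sqrf_eq0 => /(_ isT) /eqP.
Qed.

(** * Units of norm 1 and the multiplier theorem *)

Section Units.
Variable G : finZmodType.
Implicit Types (A f y : gring G) (g h : G).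

Lemma gring_natI n f f' : (0 < n)%N -> n%:R * f = n%:R * f' -> f = f'.
Proof.
move=> n0 /eqP; rewrite -subr_eq0 -mulrBr mulr_natl => /eqP h; apply/eqP.
rewrite -subr_eq0; apply/eqP/gringP => k; move: (congr1 (fun f : gring G => f k) h).
by rewrite pmulrn gringMz gring0 => /eqP; rewrite mulrz_eq0 => /orP[|/eqP]; [lia|].
Qed.

(** The coefficient of y y^* at the identity is a sum of integer squares, so exactly one coefficient
    of y is nonzero. *)
Lemma gunit y : y * star y = 1 ->
  exists g (e : int), (e = 1 \/ e = -1) /\ y = gsingle g *~ e.
Proof.
move=> /(congr1 (fun f : gring G => f 0)); rewrite corr0E -gsingle0 gsingleE eqxx.
move=> /sqr_sum1 [g [he h0]]; exists g, (y g); split=> //.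
apply: gringP => k; rewrite gringMz gsingleE; case: eqP => [->|/eqP /h0 ->].
  by rewrite intz.
by rewrite mul0rz.
Qed.

Definition aug f : int := \sum_g f g.

Lemma aug_push f : aug f = push (fun=> 0 : 'I_1) f 0.
Proof. by rewrite pushE; apply: eq_bigl. Qed.

Lemma augM f f' : aug (f * f') = aug f * aug f'.
Proof.
rewrite !aug_push pushM; last by move=> x y; rewrite addr0.
by rewrite gringM big_ord1 subrr.
Qed.

Lemma aug_frob t f : aug (frob t f) = aug f.
Proof. by rewrite !aug_push /frob push_comp. Qed.

Lemma aug_star f : aug (star f) = aug f.
Proof. by rewrite !aug_push /star push_comp. Qed.

Lemma aug_single g : aug (gsingle g) = 1.
Proof. by rewrite aug_push push_single gsingleE eqxx. Qed.

Lemma augMz f (z : int) : aug (f *~ z) = aug f * z.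
Proof. by rewrite /aug mulr_suml; apply: eq_bigr => i _; rewrite gringMz mulrzz. Qed.

Lemma augMn f n : aug (f *+ n) = aug f *+ n.
Proof. by rewrite pmulrn augMz -mulrzz pmulrn. Qed.

Lemma aug1 : aug 1 = 1.
Proof. by rewrite -gsingle0 aug_single. Qed.

Lemma aug_corr A n : A * star A = n%:R -> aug A ^+ 2 = n%:R.
Proof. by move/(congr1 aug); rewrite augM aug_star augMn aug1. Qed.

(** Multiplying n y = frob t A * A^* by its star gives n^2, so y has norm 1 and is a signed group
    element; multiplying by A gives frob t A = y A. The sign is + because [frob t] preserves the
    augmentation, which is nonzero. *)
Lemma multiplier A n t y : (0 < n)%N -> A * star A = n%:R ->
  frob t A * star A = n%:R * y -> exists g, frob t A = gsingle g * A.
Proof.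
move=> n0 hA hy.
have hyy : y * star y = 1.
  apply: (gring_natI n0); apply: (gring_natI n0); rewrite mulr1.
  rewrite mulrA mulrACA (_ : n%:R * y * _ = (n%:R * y) * star (n%:R * y)); last first.
    by rewrite rmorphM rmorph_nat mulrA mulrAC.
  rewrite -hy rmorphM /= starK mulrACA [star A * A]mulrC -frob_star -rmorphM /=.
  by rewrite hA rmorph_nat.
have [g [e [he hye]]] := gunit hyy.
have hFA : frob t A = (gsingle g * A) *~ e.
  apply: (gring_natI n0); rewrite -{1}hA mulrAC -mulrA hy hye.
  by rewrite -mulrzAl; ring.
exists g; rewrite hFA; case: he => he; rewrite ?he //.
exfalso; move: (congr1 aug hFA); rewrite aug_frob augMz augM aug_single he.
by have := aug_corr hA; move: (aug A) => a; nia.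
Qed.

End Units.

Section Multipliers.
Variable G : finZmodType.
Implicit Types (A f y : gring G) (g h : G).

(** Stability of the ideal of A yields s with frob (t^j) A congruent to A s modulo a^m.
    Multiplication by A^* turns A s into n s, which n' divides. The absolute case is t = p = a and c
    = 1. *)
Lemma frob_corr_dvd p t m n n' r (u : nat) (a c : gring G) j A (w : gring G) :
  prime p -> (0 < u)%N -> (forall g, g *+ (t ^ u) = g) ->
  dvc a c 1 p%:R -> frob t a = a -> frob t c = c ->
  (forall g, dvc a c 1 (gsingle (g *+ t) - gsingle (g *+ p))) ->
  n = (n' * r)%N -> a ^+ m * c = n'%:R * w * c -> A * star A = n%:R ->
  exists y, frob (t ^ j) A * star A * c = n'%:R * y * c.
Proof.
move=> pp u0 htu pa ta tc tp -> hw hA.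
have tp' x : eqc a c 1 (frob t x) (x ^+ p).
  have [z hz] := frob_prime x pp.
  rewrite /eqc hz opprD addrA; apply: dvcD; last exact/dvcN/dvcMr.
  elim/gring_ind: x {z hz} => [|x g IH|x g IH].
  - by exists 0; rewrite !raddf0 addr0 mulr0 !mul0r.
  - rewrite (raddfD (frob t)) (raddfD (frob p)) /= !frob_single (_ : _ - _ = (frob t x - frob p x) +
      (gsingle (g *+ t) - gsingle (g *+ p))); last by ring.
    exact: dvcD.
  - rewrite (raddfB (frob t)) (raddfB (frob p)) /= !frob_single (_ : _ - _ = (frob t x - frob p x) -
      (gsingle (g *+ t) - gsingle (g *+ p))); last by ring.
    by apply: dvcD => //; apply: dvcN.
have tu (x : gring G) : iter u (frob t) x = x by rewrite iter_frob; apply: push_id.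
have [s [d hd]] := frobenius_iter_ideal pa ta tc tp' u0 (prime_gt1 pp) tu j m A.
rewrite iter_frob in hd; exists (r%:R * s + w * d * star A).
have -> : frob (t ^ j) A * star A * c =
   (frob (t ^ j) A - A * s) * c * star A + (A * star A) * s * c by ring.
rewrite hd hA natrM (_ : a ^+ m * d * c * _ = a ^+ m * c * (d * star A)); last by ring.
by rewrite hw; ring.
Qed.

Lemma frob_corr_dvd_prime p m n r (u : nat) j A :
  prime p -> (0 < u)%N -> (forall g, g *+ (p ^ u) = g) ->
  n = (p ^ m * r)%N -> A * star A = n%:R ->
  exists y, frob (p ^ j) A * star A = (p ^ m)%:R * y.
Proof.
move=> pp u0 hu hn hA.
have [y] : exists y, frob (p ^ j) A * star A * 1 = (p ^ m)%:R * y * 1.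
  apply: (@frob_corr_dvd p p m n _ r u p%:R 1 j A 1) => //.
  - by exists 1; rewrite expr1; ring.
  - by rewrite rmorph_nat.
  - by rewrite rmorph1.
  - by move=> g; exists 0; rewrite subrr mulr0 !mul0r.
  - by rewrite natrX; ring.
by rewrite !mulr1 => hy; exists y.
Qed.

(** As in [multiplier], but the sign stays: the elements c of the applications have augmentation 0,
    so it cannot be read off from A c. *)
Lemma multiplier_rel A n t c y : (0 < n)%N -> A * star A = n%:R -> frob t c = c ->
  frob t A * star A * c = n%:R * y * c ->
  (forall z, (z * c) * star (z * c) = c * star c ->
     exists g (e : int), (e = 1 \/ e = -1) /\ z * c = (gsingle g * c) *~ e) ->
  exists g (e : int), (e = 1 \/ e = -1) /\ frob t (A * c) = (gsingle g * (A * c)) *~ e.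
Proof.
move=> n0 hA hc hy hunit.
have hyy : (y * c) * star (y * c) = c * star c.
  apply: (gring_natI n0); apply: (gring_natI n0).
  rewrite mulrA mulrACA (_ : n%:R * (y * c) * _ = (n%:R * y * c) * star (n%:R * y * c)); last first.
    by rewrite !rmorphM rmorph_nat /=; ring.
  rewrite -hy !rmorphM /= starK.
  have -> : frob t A * star A * c * (star (frob t A) * A * star c) =
    (frob t A * star (frob t A)) * (A * star A) * (c * star c) by ring.
  by rewrite -frob_star -rmorphM /= hA rmorph_nat; ring.
have [g [e [he hye]]] := hunit y hyy.
exists g, e; split=> //; apply: (gring_natI n0).
rewrite rmorphM /= hc.
have -> : n%:R * (frob t A * c) = (frob t A * star A * c) * A by rewrite -hA; ring.
rewrite hy (_ : _ * A = n%:R * (A * (y * c))); last by ring.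
by rewrite hye !mulrzAr; congr (_ *~ _); ring.
Qed.

(** Translation by h negates z c, whose squared coefficients sum to 2; so z c lives on one coset of
    h, with values 1 and -1. *)
Lemma unit_rel2 h z : h != 0 -> h + h = 0 ->
  let c := 1 - gsingle h in (z * c) * star (z * c) = c * star c ->
  exists g (e : int), (e = 1 \/ e = -1) /\ z * c = (gsingle g * c) *~ e.
Proof.
move=> h0 hh c; set Y := z * c => hY.
have Yh k : Y (k - h) = - Y k.
  have : gsingle h * Y = - Y.
    rewrite /Y /c mulrCA mulrBr mulr1 gsingleM hh gsingle0; ring.
  by move/(congr1 (fun f : gring G => f k)); rewrite gsingleMl gringN.
have cE k : c k = (k == 0)%:R - (k == h)%:R.
  by rewrite /c gaddE gringN -gsingle0 !gsingleE.
have nh0 : - h = h by apply/eqP; rewrite eq_sym -subr_eq0 opprK hh.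
have c2 : (c * star c) 0 = 2.
  rewrite corr0E (bigD1 0) //= (bigD1 h) //= big1 => [|i /andP[/negbTE hi /negbTE hi']].
    by rewrite !cE !eqxx [0 == h]eq_sym (negbTE h0).
  by rewrite cE hi hi'.
move: (congr1 (fun f : gring G => f 0) hY); rewrite c2 corr0E => hs.
have [g hg] : exists g, Y g != 0.
  apply/existsP; rewrite -negb_forall; apply/negP => /forallP h1.
  by move: hs; rewrite big1 // => i _; move/eqP: (h1 i) ->.
have gh : g - h != g by rewrite -subr_eq0 addrAC subrr add0r oppr_eq0.
move: hs; rewrite (bigD1 g) //= (bigD1 (g - h)) //= Yh.
set s := \sum_(j | _) _ => hs.
have s0 : 0 <= s by apply: sumr_ge0 => j _; apply: sqr_ge0.
have /eqP : s = 0 by move: hg hs s0; move: (Y g) => a; nia.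
have hg1 : Y g = 1 \/ Y g = -1 by move: hg hs s0; move: (Y g) => a; nia.
rewrite /s psumr_eq0 => [/allP hz|j _]; last exact: sqr_ge0.
exists g, (Y g); split=> //; apply: gringP => k.
rewrite gringMz gsingleMl cE subr_eq0.
have -> : (k - g == h) = (k == g - h) by rewrite subr_eq nh0 addrC.
case: (eqVneq k g) => [->|kg]; first by rewrite eq_sym (negbTE gh) subr0 intz.
case: (eqVneq k (g - h)) => [->|kgh]; first by rewrite Yh sub0r mulNrz intz.
have := hz k; rewrite mem_index_enum kg kgh sqrf_eq0 => /(_ isT) /eqP ->.
by rewrite subr0 mul0rz.
Qed.

End Multipliers.

Section Multipliers3.
Variable G : finZmodType.
Implicit Types (A f y : gring G) (g h : G).

(** The coefficients of z c sum to 0 on each coset of h, so a coset contributes a^2 + b^2 + (a +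
    b)^2 to the total 2. One coset takes all of it, with values 1, -1 and 0 in some order. *)
Lemma unit_rel3 h z : h != 0 -> h *+ 3 = 0 ->
  let c := 1 - gsingle h in (z * c) * star (z * c) = c * star c ->
  exists g (e : int), (e = 1 \/ e = -1) /\ z * c = (gsingle g * c) *~ e.
Proof.
move=> h0 h3 c; set Y := z * c => hY.
have nh : - h = h + h.
  by apply/eqP; rewrite eq_sym -subr_eq0 opprK -h3 !mulrS mulr0n addr0 addrA.
have nhh : - (h + h) = h by rewrite -nh opprK.
have Yh k : Y k + Y (k + h) + Y (k - h) = 0.
  have : Y + gsingle (- h) * Y + gsingle h * Y = 0.
    rewrite /Y /c (_ : _ + _ = z * (1 + gsingle (- h) - gsingle h * gsingle h
      - gsingle (- h) * gsingle h)); last by ring.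
    by rewrite !gsingleM addNr gsingle0 nh addrK subrr mulr0.
  move/(congr1 (fun f : gring G => f k)).
  by rewrite !gaddE !gsingleMl opprK gring0.
have cE k : c k = (k == 0)%:R - (k == h)%:R.
  by rewrite /c gaddE gringN -gsingle0 !gsingleE.
have c2 : (c * star c) 0 = 2.
  rewrite corr0E (bigD1 0) //= (bigD1 h) //= big1 => [|i /andP[/negbTE hi /negbTE hi']].
    by rewrite !cE !eqxx [0 == h]eq_sym (negbTE h0).
  by rewrite cE hi hi'.
move: (congr1 (fun f : gring G => f 0) hY); rewrite c2 corr0E => hs.
have [g hg] : exists g, Y g != 0.
  apply/existsP; rewrite -negb_forall; apply/negP => /forallP h1.
  by move: hs; rewrite big1 // => i _; move/eqP: (h1 i) ->.
have gh : g + h != g by rewrite -subr_eq0 addrAC subrr add0r.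
have gh' : g - h != g by rewrite -subr_eq0 addrAC subrr add0r oppr_eq0.
have ghh : g - h != g + h.
  by rewrite (inj_eq (addrI g)) nh -subr_eq0 addrK.
have := hs; rewrite (bigD1 g) //= (bigD1 (g + h)) //= (bigD1 (g - h)) /=; last first.
  by rewrite gh' ghh.
set s := \sum_(j | _) _ => hs'.
have s0 : 0 <= s by apply: sumr_ge0 => j _; apply: sqr_ge0.
have hgs : Y (g - h) = - Y g - Y (g + h) by have := Yh g; lia.
rewrite hgs in hs'.
have [hab hsz] : ((Y g = 1 \/ Y g = -1) /\ (Y (g + h) = 0 \/ Y (g + h) = - Y g)) /\ s = 0.
  by move: hg hs' s0; move: (Y g) (Y (g + h)) => a b; nia.
case: hab => hg1 hb.
move/eqP: hsz; rewrite /s psumr_eq0 => [/allP hz|j _]; last exact: sqr_ge0.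
have hk k : k != g -> k != g + h -> k != g - h -> Y k = 0.
  move=> k1 k2 k3; have := hz k; rewrite mem_index_enum k1 k2 k3 sqrf_eq0.
  by move=> /(_ isT) /eqP.
case: hb => hb.
  (* Here Y vanishes at g + h, so its support is the pair g - h, g and the translate of c starts at
     g - h. *)
  exists (g - h), (- Y g); split; first by case: hg1 => ->; [right|left].
  apply: gringP => k.
  rewrite gringMz gsingleMl cE subr_eq0.
  have -> : (k - (g - h) == h) = (k == g) by rewrite subr_eq addrCA subrr addr0.
  case: (eqVneq k (g - h)) => [->|k3].
    by rewrite (negbTE gh') subr0 hgs hb subr0 intz.
  case: (eqVneq k g) => [->|k1]; first by rewrite sub0r mulNrz mulrNz opprK intz.
  case: (eqVneq k (g + h)) => [->|k2]; first by rewrite hb subr0 mul0rz.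
  by rewrite hk // subr0 mul0rz.
exists g, (Y g); split=> //; apply: gringP => k.
rewrite gringMz gsingleMl cE subr_eq0.
have -> : (k - g == h) = (k == g + h) by rewrite subr_eq addrC.
case: (eqVneq k g) => [->|k1]; first by rewrite eq_sym (negbTE gh) subr0 intz.
case: (eqVneq k (g + h)) => [->|k2]; first by rewrite hb sub0r mulNrz intz.
case: (eqVneq k (g - h)) => [->|k3]; first by rewrite hgs hb subrr subr0 mul0rz.
by rewrite hk // subr0 mul0rz.
Qed.

End Multipliers3.

(** * Soundness of the search *)

Lemma dot_trim cs xs : dot (trim cs) xs = dot cs xs.
Proof.
elim: cs xs => [|c cs IH] [|x xs] //=.
  by case: (trim cs) => [|? ?] //; case: Z.eqb.
rewrite -IH; case: (trim cs) => [|? ?] //.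
by case: Z.eqb_spec => [->|] //=; rewrite Z.mul_0_l.
Qed.

Definition lineq (xs : seq Z) (e : Z * seq Z) : Prop := e.1 = dot e.2 xs.

Lemma stepP x xs es : (forall e, e \in es -> lineq (x :: xs) e) ->
  exists2 es', step x es = Some es' & forall e, e \in es' -> lineq xs e.
Proof.
elim: es => [|[r [|c cs]] es IH] h /=; first by exists [::].
- have -> : r = Z0 by have := h (r, [::]) (mem_head _ _).
  by apply: IH => e he; apply: h; rewrite inE he orbT.
- have [es' h1 h2] : exists2 es', step x es = Some es' & forall e, e \in es' -> lineq xs e.
    by apply: IH => e he; apply: h; rewrite inE he orbT.
  have := h (r, c :: cs) (mem_head _ _); rewrite /lineq /= => hr.
  case: cs hr {h} => [|c' cs] hr.
    rewrite h1; case: Z.eqb_spec => [_|]; first by exists es'.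
    by case; rewrite hr /=; lia.
  rewrite h1; eexists; first by []; move=> e; rewrite inE => /orP[/eqP ->|/h2 //].
  by rewrite /lineq hr; case: (xs) => [|y ys] /=; lia.
Qed.

Lemma optionsP n dom (lev : seq (Z * nat)) es q acc (f : nat -> Z) :
  (forall sr, sr \in lev -> (0 <= sr.1) && (f sr.2 \in dom sr.2)) ->
  (forall e, e \in es -> lineq [seq f sr.2 | sr <- lev] e) ->
  q + \sum_(sr <- lev) sr.1 * f sr.2 ^+ 2 <= n ->
  (q + \sum_(sr <- lev) sr.1 * f sr.2 ^+ 2, rev [seq f sr.2 | sr <- lev] ++ acc)
    \in options n dom lev es q acc.
Proof.
elim: lev es q acc => [|[sz r] lev IH] es q acc hd he hq /=.
  by rewrite big_nil addr0 inE.
have [es' hs he'] := stepP he; rewrite big_cons /=.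
have hd' sr : sr \in lev -> (0 <= sr.1) && (f sr.2 \in dom sr.2).
  by move=> h; apply: hd; rewrite inE h orbT.
have /andP[/= sz0 fr] := hd (sz, r) (mem_head _ _).
rewrite big_cons /= addrA in hq.
have s0 : 0 <= \sum_(sr <- lev) sr.1 * f sr.2 ^+ 2.
  rewrite big_seq; apply: sumr_ge0 => sr /hd' /andP[h1 _].
  by apply: mulr_ge0 => //; apply: sqr_ge0.
apply/flatten_mapP; exists (f r) => //.
rewrite -[Z.add _ _]/(q + sz * f r ^+ 2).
have -> : Z.leb (q + sz * f r ^+ 2) n.
  by have := le_trans (ler_wpDr s0 (lexx _)) hq; lia.
rewrite hs rev_cons cat_rcons addrA.
exact: IH.
Qed.

Lemma combineP idx T (os : seq (seq (Z * seq Z))) (ch : seq (Z * seq Z)) q acc l :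
  size ch = size os ->
  (forall i, (i < size os)%N -> nth (0, [::]) ch i \in nth [::] os i) ->
  (forall c, c \in ch -> 0 <= c.1) -> q = \sum_(c <- ch) c.1 ->
  [seq nth 0 (foldl (fun acc c => c.2 ++ acc) acc ch) i | i <- idx] = l ->
  corr_ok l (behead (l ++ l)) (behead T) ->
  l \in combine idx T os q acc.
Proof.
elim: os ch q acc => [|o os IH] [|c ch] q acc //= hs hm h0 hq hl hc.
  by rewrite hq big_nil /= hl hc inE.
apply/flatten_mapP; exists c; first exact: (hm 0%N).
have s0 : 0 <= \sum_(c <- ch) c.1.
  by rewrite big_seq; apply: sumr_ge0 => a ha; apply: h0; rewrite inE ha orbT.
have -> : Z.sub q c.1 = \sum_(c <- ch) c.1 by rewrite -[Z.sub _ _]/(q - c.1) hq big_cons addrAC subrr add0r.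
have -> : Z.leb 0 (\sum_(c <- ch) c.1).
  by move: s0; move: (\sum_(_ <- _) _) => S; lia.
apply: (IH ch) => //; first by case: hs.
  by move=> i; exact: (hm i.+1).
by move=> a ha; apply: h0; rewrite inE ha orbT.
Qed.

Lemma min_norm_le n o c : c \in o -> min_norm n o <= c.1.
Proof.
elim: o => //= a o IH; rewrite inE => /orP[/eqP ->|/IH]; rewrite /min_norm /=; lia.
Qed.

Lemma dotE (a b : seq Z) : (size a <= size b)%N ->
  dot a b = \sum_(i < size a) nth 0 a i * nth 0 b i.
Proof.
elim: a b => [|x a IH] [|y b] //= h; rewrite ?big_ord0 // big_ord_recl /= IH //.
Qed.

Lemma corr_okP (l T : seq Z) : (0 < size l)%N -> size T = size l ->
  (forall s, (s < size l)%N ->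
     \sum_(k < size l) nth 0 l k * nth 0 l ((k + s) %% size l) = nth 0 T s) ->
  corr_ok l (behead (l ++ l)) (behead T).
Proof.
move=> l0 sT h; rewrite -drop1 -[behead T]drop1.
have : (1 <= size l)%N by [].
(* This form allows an induction on the number of shifts still to be checked. *)
have -> : drop 1 T = drop (size l - (size l - 1)) T by rewrite subKn.
have -> : drop 1 (l ++ l) = drop (size l - (size l - 1)) (l ++ l) by rewrite subKn.
have : (size l - 1 <= size l)%N by rewrite leq_subr.
elim: (size l - 1)%N => [|m IH] hm _; first by rewrite subn0 -sT drop_size.
set s := (size l - m.+1)%N.
have sl : (s < size l)%N by rewrite /s; lia.
rewrite (drop_nth 0 (s := T)) ?sT //=.
have -> : dot l (drop s (l ++ l)) = nth 0 T s.
  rewrite dotE; last by rewrite size_drop size_cat; lia.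
  rewrite -h //; apply: eq_bigr => k _; congr (_ * _).
  rewrite nth_drop nth_cat addnC; case: ltnP => hk; first by rewrite modn_small.
  rewrite -[in RHS](subnK hk) modnDr modn_small //.
  by rewrite ltn_subLR // -addSn leq_add // ltnW.
rewrite Z.eqb_refl -drop1 drop_drop.
have -> : (1 + s = size l - m)%N by rewrite /s; lia.
have -> : s.+1 = (size l - m)%N by rewrite /s; lia.
by apply: IH => //; lia.
Qed.

(** The specification of the search. Only one direction is proved, that [solve] returns every
    feasible list; nonexistence needs no more. *)
Record feasible (t v : nat) (ws : seq nat) (T : seq Z) (dom : nat -> seq Z)
    (Bs : seq (seq Z)) (l : seq Z) : Prop := Feasible {
  feasible_size : size l = v;
  feasible_fix : forall k, (k < v)%N -> nth 0 l (k * t %% v) = nth 0 l k;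
  feasible_dom : forall k, (k < v)%N -> nth 0 l k \in dom k;
  feasible_proj : forall i j, (i < size ws)%N -> (j < nth 0%N ws i)%N ->
    \sum_(k <- iota 0 v | (k %% nth 0%N ws i == j)%N) nth 0 l k = nth 0 (nth [::] Bs i) j;
  feasible_corr : forall s, (s < v)%N ->
    \sum_(k < v) nth 0 l k * nth 0 l ((k + s) %% v) = nth 0 T s }.

Lemma Z_of_natE n : Z.of_nat n = n%:R.
Proof. by elim: n => // n IH; rewrite mulrS -IH; lia. Qed.

Lemma count_residue w q j : (j < w)%N ->
  count (fun k => k %% w == j)%N (iota 0 (q * w)) = q.
Proof.
move=> jw; elim: q => [|q IH] //; rewrite mulSn addnC iotaD count_cat IH add0n -addn1.
congr (_ + _)%N; rewrite -[(q * w)%N]addn0 iotaDl count_map.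
rewrite (eq_in_count (a2 := pred1 j)) => [|k]; last first.
  by rewrite mem_iota /= => hk; rewrite modnMDl modn_small.
by rewrite count_uniq_mem ?iota_uniq // mem_iota jw.
Qed.

Section Soundness.
Variables (t v w : nat) (ws : seq nat) (T : seq Z) (dom : nat -> seq Z)
  (Bs : seq (seq Z)) (l : seq Z).
Hypotheses (v_gt0 : (0 < v)%N) (gs_ok : groups_ok t v w)
  (ws_ok : all (fun w => (0 < w) && (w %| v))%N ws) (T_size : size T = v)
  (l_ok : feasible t v ws T dom Bs l).

Let os := flatten (groups t v w).

(** A list of v entries that covers v distinct numbers contains each exactly once. *)
Lemma os_perm : perm_eq (iota 0 v) (flatten os).
Proof.
have /and3P[_ /eqP hs /allP hk] := gs_ok.
have hu := leq_size_uniq (iota_uniq 0 v) hk; rewrite size_iota hs leqnn in hu.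
apply: uniq_perm (iota_uniq 0 v) (hu isT) _.
by have [] := uniq_min_size (iota_uniq 0 v) hk; rewrite ?size_iota ?hs.
Qed.

Lemma os_lt k : k \in flatten os -> (k < v)%N.
Proof. by rewrite -(perm_mem os_perm) mem_iota. Qed.

Lemma os_const o k : o \in os -> k \in o -> nth 0 l k = nth 0 l (head 0%N o).
Proof.
move=> ho; have /and3P[/allP /(_ o ho) + _ _] := gs_ok.
have : forall k, k \in o -> (k < v)%N.
  by move=> k' hk'; apply: os_lt; apply/flattenP; exists o.
case: o {ho} => //= r o; elim: o r k => [|x o IH] r k hlt /=.
  by rewrite mem_seq1 => _ /eqP ->.
move=> /andP[/eqP hx hp]; rewrite inE => /orP[/eqP -> //|hk].
rewrite (IH x) // => [|k' hk']; last by apply: hlt; rewrite inE hk' orbT.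
by rewrite hx (feasible_fix l_ok) // hlt ?mem_head.
Qed.

Let lev (g : seq (seq nat)) := [seq (Z.of_nat (size o), head 0%N o) | o <- g].

Lemma lev_values g : [seq nth 0 l sr.2 | sr <- lev g] = [seq nth 0 l (head 0%N o) | o <- g].
Proof. by rewrite /lev -map_comp. Qed.

Lemma lev_norm g : {subset g <= os} ->
  \sum_(sr <- lev g) sr.1 * nth 0 l sr.2 ^+ 2 = \sum_(k <- flatten g) nth 0 l k ^+ 2.
Proof.
elim: g => [|o g IH] hg; first by rewrite !big_nil.
rewrite big_cons big_cat /= IH => [|o' ho']; last by apply: hg; rewrite inE ho' orbT.
congr (_ + _); rewrite [RHS](eq_big_seq (fun=> nth 0 l (head 0%N o) ^+ 2)); last first.
  by move=> k hk; rewrite (@os_const o) // hg ?mem_head.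
rewrite big_const_seq count_predT iter_addr_0 -mulr_natl; congr (_ * _).
by rewrite Z_of_natE.
Qed.

Lemma dot_coefs w' j g : {subset g <= os} ->
  dot (coefs w' j g) [seq nth 0 l (head 0%N o) | o <- g] =
  \sum_(k <- flatten g | (k %% w' == j)%N) nth 0 l k.
Proof.
elim: g => [|o g IH] hg; first by rewrite big_nil.
rewrite /= big_cat /= -IH => [|o' ho']; last by apply: hg; rewrite inE ho' orbT.
congr (_ + _); rewrite -big_filter.
rewrite [RHS](eq_big_seq (fun=> nth 0 l (head 0%N o))) => [|k]; last first.
  by rewrite mem_filter => /andP[_ hk]; rewrite (@os_const o) // hg ?mem_head.
by rewrite big_const_seq count_predT iter_addr_0 size_filter -mulr_natl Z_of_natE.
Qed.

(** Exactly v / w' positions lie over j, so a group with that many leaves none to the other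
    groups. *)
Lemma group_sum w' j g1 g g2 : groups t v w = g1 ++ g :: g2 ->
  (0 < w')%N -> (w' %| v)%N -> (j < w')%N ->
  count (fun k => k %% w' == j)%N (flatten g) = (v %/ w')%N ->
  \sum_(k <- flatten g | (k %% w' == j)%N) nth 0 l k =
  \sum_(k <- iota 0 v | (k %% w' == j)%N) nth 0 l k.
Proof.
move=> hg w0 wv jw hc; pose P k := (k %% w' == j)%N.
have hp : perm_eq (iota 0 v) (flatten g ++ flatten (flatten (g1 ++ g2))).
  apply: perm_trans os_perm _; rewrite /os hg !flatten_cat.
  by rewrite perm_catCA.
have /permP /(_ P) := hp.
rewrite count_cat hc -{1}(divnK wv) count_residue // => h0.
rewrite (perm_big _ hp) /= big_cat /= [X in _ = _ + X]big1_seq ?addr0 // => k.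
move=> /andP[hPk hk]; exfalso; have : has P (flatten (flatten (g1 ++ g2))).
  by apply/hasP; exists k.
move: h0 => /eqP; rewrite -[X in X == _]addn0 eqn_add2l eq_sym => /eqP h0.
by rewrite has_count h0.
Qed.

Lemma group_eqs_hold g1 g g2 e : groups t v w = g1 ++ g :: g2 ->
  e \in group_eqs t v ws g ->
  lineq [seq nth 0 l sr.2 | sr <- lev g] (nth 0 (nth [::] Bs e.1.1) e.1.2, e.2).
Proof.
move=> hg /flatten_mapP[i]; rewrite mem_iota /= => hi /mapP[j].
rewrite mem_filter => /andP[/eqP hc _] -> /=.
have /(all_nthP 0%N) /(_ i hi) /andP[w0 wv] := ws_ok.
have jw : (j < nth 0%N ws i)%N.
  have : has (fun k => k %% nth 0%N ws i == j)%N (flatten g).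
    by rewrite has_count hc divn_gt0 // dvdn_leq.
  by case/hasP => k _ /eqP <-; rewrite ltn_pmod.
rewrite /lineq /= dot_trim lev_values dot_coefs; last first.
  move=> o ho; rewrite /os hg flatten_cat mem_cat /= mem_cat ho orbT //.
by rewrite (group_sum hg) // (feasible_proj l_ok).
Qed.

Lemma index_tableP :
  [seq nth 0 (rev [seq nth 0 l (head 0%N o) | o <- os]) i | i <- index_table t v w] = l.
Proof.
transitivity (mkseq (nth 0 l) v); last by rewrite -(feasible_size l_ok) mkseq_nth.
rewrite /index_table -/os -map_comp; apply/eq_in_map => k hk /=.
have hh : has (fun o => k \in o) (rev os).
  by apply/hasP; move: hk; rewrite (perm_mem os_perm) => /flattenP[o ho hko];
    exists o; rewrite ?mem_rev.
rewrite -map_rev (nth_map [::]) -?has_find //.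
symmetry; apply: os_const; first by rewrite -mem_rev mem_nth // -has_find.
exact: (nth_find [::] hh).
Qed.

Lemma solve1P : l \in solve1 (plan t v w ws) (index_table t v w) T dom Bs.
Proof.
have n_eq : head 0 T = \sum_(k <- iota 0 v) nth 0 l k ^+ 2.
  rewrite -nth0 -(feasible_corr l_ok) //.
  have -> : iota 0 v = index_iota 0 v by rewrite /index_iota subn0.
  rewrite [RHS]big_mkord.
  by apply: eq_bigr => k _; rewrite addn0 modn_small // expr2.
pose gs := groups t v w.
pose sq (g : seq (seq nat)) := \sum_(k <- flatten g) nth 0 l k ^+ 2.
have n_gs : head 0 T = \sum_(g <- gs) sq g.
  rewrite n_eq (perm_big _ os_perm) /= /os -/gs.
  elim: (gs) => [|g s IH]; first by rewrite !big_nil.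
  by rewrite big_cons -IH /= flatten_cat big_cat.
have sq_ge0 g : 0 <= sq g by apply: sumr_ge0 => k _; apply: sqr_ge0.
set n := head 0 T in n_eq n_gs *.
pose opt g := options n dom (lev g)
  [seq (nth 0 (nth [::] Bs e.1.1) e.1.2, e.2) | e <- group_eqs t v ws g] 0 [::].
rewrite /solve1 -/n /plan -/gs -[[seq _ | le <- map _ gs]]map_comp -/(map opt gs) -map_comp.
have opt_in g : g \in gs ->
    (sq g, rev [seq nth 0 l (head 0%N o) | o <- g]) \in opt g.
  move=> hg; rewrite /opt /=.
  have hsub : {subset g <= os} by move=> o ho; apply/flattenP; exists g.
  have [g1 [g2 hgs]] : exists g1 g2, gs = g1 ++ g :: g2.
    by case/splitPr: hg => g1 g2; exists g1, g2.
  have := @optionsP n dom (lev g) [seq (nth 0 (nth [::] Bs e.1.1) e.1.2, e.2)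
    | e <- group_eqs t v ws g] 0 [::] (nth 0 l).
  rewrite add0r lev_norm // lev_values cats0; apply.
  - move=> sr /mapP[o ho ->] /=; apply/andP; split; first by lia.
    apply: (feasible_dom l_ok); apply: os_lt; apply/flattenP; exists o; first exact: hsub.
    have /and3P[/allP /(_ o (hsub o ho))] := gs_ok.
    by case: (o) => // r o' _ _ _; rewrite mem_head.
  - by move=> e /mapP[e' he' ->]; rewrite -lev_values; apply: group_eqs_hold he'; exact: hgs.
  - rewrite n_gs (big_rem g) //= lerDl.
    by apply: sumr_ge0 => k _; exact: sq_ge0.
(* The options that reproduce l, with norms lowered by the group minima as in [solve1]. *)
pose ch := [seq (sq g - min_norm n (opt g), rev [seq nth 0 l (head 0%N o) | o <- g]) | g <- gs].
apply: (@combineP _ _ _ ch).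
- by rewrite !size_map.
- move=> i; rewrite size_map => hi.
  rewrite /ch (nth_map [::]) // [X in X \in _](nth_map [::]) //.
  apply/mapP; exists (sq (nth [::] gs i), rev [seq nth 0 l (head 0%N o) | o <- nth [::] gs i]) => //.
  exact: (opt_in _ (mem_nth [::] hi)).
- move=> c /mapP[g hg ->] /=; rewrite subr_ge0.
  exact: min_norm_le (opt_in g hg).
- rewrite big_map /= sumrB -n_gs.
  suff hf q : foldl (fun q o => Z.sub q (min_norm n o)) q [seq opt i | i <- gs] =
      q - \sum_(i <- gs) min_norm n (opt i) by rewrite -hf.
  elim: (gs) q => [|g s IH] q; first by rewrite big_nil subr0.
  by rewrite /= IH big_cons opprD addrA.
- rewrite -[RHS]index_tableP; apply/eq_in_map => i _; congr (nth 0 _ i).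
  rewrite /os -/gs /ch.
  have: forall acc, foldl (fun acc c => c.2 ++ acc) acc
      [seq (sq g - min_norm n (opt g), rev [seq nth 0 l (head 0%N o) | o <- g]) | g <- gs] =
    rev [seq nth 0 l (head 0%N o) | o <- flatten gs] ++ acc.
    elim: (gs) => [|g s IH] acc //=.
    by rewrite IH map_cat rev_cat catA.
  by move=> ->; rewrite cats0.
- apply: corr_okP; rewrite ?(feasible_size l_ok) //.
  exact: feasible_corr l_ok.
Qed.

End Soundness.

Definition stage_ok (t v w : nat) (ws : seq nat) (T : seq Z) : bool :=
  [&& (0 < v)%N, groups_ok t v w, all (fun w => (0 < w) && (w %| v))%N ws & size T == v].

Lemma solveP (I : eqType) t v w ws T (h : I -> (nat -> seq Z) * seq (seq Z)) s x l :
  stage_ok t v w ws T -> x \in s -> feasible t v ws T (h x).1 (h x).2 l ->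
  l \in solve t v w ws T [seq h x | x <- s].
Proof.
move=> /and4P[v0 hg hw /eqP hT] hx hl; rewrite /solve -map_comp; apply/flatten_mapP.
by exists x => //=; apply: solve1P.
Qed.

(** * Circulant weighing matrices in cyclic group rings *)

(** A is the first row of W, and the correlation of A at g is the inner product of rows 0 and g. *)
Lemma CW_gring n k (W : 'M[int]_n.+1) : circulant_weighing_matrix k W ->
  exists A : gring 'I_n.+1, (forall g, A g \in [:: 0; 1; -1]) /\ A * star A = k%:R.
Proof.
case=> [[hW hWW] hc]; exists [ffun j => W 0 j].
have shift m (i j : 'I_n.+1) : i = m :> nat -> W i (i + j) = W 0 j.
  elim: m i => [|m IH] i hi.
    by rewrite (_ : i = 0) ?add0r //; apply: val_inj.
  have hm : (m < n.+1)%N by rewrite ltnW // -hi.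
  have e : i + j = ordS (Ordinal hm + j).
    by apply: val_inj; rewrite /= hi addSn -addn1 -[in RHS]addn1 modnDml.
  by rewrite e (hc (Ordinal hm)) ?hi // IH.
split=> [g|]; first by rewrite ffunE.
apply: gringP => g; rewrite corrE.
transitivity ((W *m W^T) 0 g).
  rewrite mxE; apply: eq_bigr => j _; rewrite !mxE !ffunE; congr (_ * _).
  by rewrite -(shift g g) // addrC subrK.
rewrite hWW mxE gringMn -gsingle0 gsingleE eq_sym.
by case: eqP => _; rewrite ?mulr1n ?mulr0n ?mul0rn // natz.
Qed.

Section Lists.
Variable n : nat.
Implicit Types f : gring 'I_n.+1.

Definition lst f : seq Z := mkseq (fun k => Z_of_int (f (inZp k))) n.+1.

Lemma size_lst f : size (lst f) = n.+1.
Proof. exact: size_mkseq. Qed.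

Lemma nth_lst f k : (k < n.+1)%N -> nth 0 (lst f) k = Z_of_int (f (inZp k)).
Proof. by move=> hk; rewrite nth_mkseq. Qed.

Lemma frob_fixE t u f x : (t * u = 1 %[mod n.+1])%N -> frob t f = f -> f (x *+ t) = f x.
Proof.
move=> htu hf; rewrite -{1}hf /frob push_inj //.
apply: (@can_inj _ _ _ (fun x => x *+ u)) => y.
rewrite -mulrnA Zp_mulrn; apply: val_inj => /=.
by rewrite -modnMmr htu modnMmr muln1 modn_small.
Qed.

Lemma lst_corr f s : (s < n.+1)%N ->
  \sum_(k < n.+1) nth 0 (lst f) k * nth 0 (lst f) ((k + s) %% n.+1) =
  Z_of_int ((f * star f) (inZp s)).
Proof.
move=> hs; rewrite corrE [in RHS](reindex_inj (addrI (inZp s))) rmorph_sum /=.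
apply: eq_bigr => k _; rewrite !nth_lst ?ltn_pmod // rmorphM mulrC /=.
congr (Z_of_int (f _) * Z_of_int (f _)).
  by apply: val_inj; rewrite /= modn_mod modnDml addnC.
by rewrite addrAC subrr add0r valZpK.
Qed.

End Lists.

Section Contraction.
Variables (n m : nat).
Hypothesis mn : (m.+1 %| n.+1)%N.
Implicit Types f : gring 'I_n.+1.

(* [con] is the image in the quotient of order [m.+1], not [m]. *)
Definition red (k : 'I_n.+1) : 'I_m.+1 := inZp k.
Definition con f : gring 'I_m.+1 := push red f.

Lemma redD : {morph red : x y / x + y}.
Proof. by move=> x y; apply: val_inj; rewrite /= modn_dvdm // modnDm. Qed.

Lemma red0 : red 0 = 0.
Proof. by apply: val_inj; rewrite /= mod0n. Qed.

Lemma redN : {morph red : x / - x}.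
Proof. by move=> x; apply/eqP; rewrite -subr_eq0 opprK -redD addNr red0. Qed.

Lemma redMn x k : red (x *+ k) = red x *+ k.
Proof. by elim: k => [|k IH]; rewrite ?mulr0n ?red0 // !mulrS redD IH. Qed.

HB.instance Definition _ := GRing.Additive.copy con (push red).

Fact con_multiplicative : monoid_morphism con.
Proof.
by split; [apply: push1; exact: red0 | move=> f g; apply: pushM; exact: redD].
Qed.

Lemma conM f g : con (f * g) = con f * con g.
Proof. by have [_ ->] := con_multiplicative. Qed.

Lemma con1 : con 1 = 1.
Proof. by have [-> _] := con_multiplicative. Qed.

Lemma con_nat k : con k%:R = k%:R.
Proof. by rewrite raddfMn /= con1. Qed.

Lemma con_star f : con (star f) = star (con f).
Proof. by apply: push_star; exact: redN. Qed.

Lemma con_frob t f : con (frob t f) = frob t (con f).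
Proof. by rewrite /con /frob !push_comp; apply: eq_push => x /=; rewrite redMn. Qed.

Lemma con_single g : con (gsingle g) = gsingle (red g).
Proof. exact: push_single. Qed.

Lemma conE f j : con f j = \sum_(g | red g == j) f g.
Proof. exact: pushE. Qed.

Lemma lst_con f j : (j < m.+1)%N ->
  \sum_(k <- iota 0 n.+1 | (k %% m.+1 == j)%N) nth 0 (lst f) k = nth 0 (lst (con f)) j.
Proof.
move=> hj; have -> : iota 0 n.+1 = index_iota 0 n.+1 by rewrite /index_iota subn0.
rewrite nth_lst // conE rmorph_sum big_mkord; apply: eq_big => [k|k _].
  by rewrite -val_eqE /= (modn_small hj).
by rewrite nth_lst // valZpK.
Qed.

Lemma con_bound f (b : int) : (forall g, `|f g| <= b) ->
  forall j, `|con f j| <= b * (n.+1 %/ m.+1)%:R.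
Proof.
move=> hb j; rewrite conE; apply: le_trans (ler_norm_sum _ _ _) _.
apply: le_trans (ler_sum _ (fun g _ => hb g)) _.
rewrite sumr_const mulr_natr ler_wpMn2l //; first by apply: le_trans (hb 0).
rewrite -(@count_residue m.+1 (n.+1 %/ m.+1) j) // divnK //.
rewrite cardE /enum_mem size_filter -enumT -val_enum_ord count_map.
by apply: eq_leq; apply: eq_count.
Qed.

End Contraction.

Arguments con {n} m f.

Lemma con_con n m m' (f : gring 'I_n.+1) : (m.+1 %| m'.+1)%N ->
  con m (con m' f) = con m f.
Proof.
move=> h; rewrite /con push_comp; apply: eq_push => x; apply: val_inj => /=.
by rewrite modn_dvdm.
Qed.

(** Reducing after every factor keeps the unary numbers small, so that orders modulo v can be
    checked by evaluation. *)
Definition powm (t u v : nat) : nat := iter u (fun x => x * t %% v)%N (1 %% v)%N.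

Lemma powmE t u v : powm t u v = (t ^ u %% v)%N.
Proof.
rewrite /powm; elim: u => [|u IH]; first by rewrite expn0.
by rewrite iterS IH modnMml expnSr.
Qed.

Section Cyclic.
Variable n : nat.
Implicit Types (f A : gring 'I_n.+1) (g x : 'I_n.+1).

Lemma ord_mulrn_mod x t t' : (t = t' %[mod n.+1])%N -> x *+ t = x *+ t'.
Proof.
by move=> h; rewrite !Zp_mulrn; apply: val_inj; rewrite /= -modnMmr h modnMmr.
Qed.

Lemma frob_mod t t' f : (t = t' %[mod n.+1])%N -> frob t f = frob t' f.
Proof. by move=> h; apply: eq_push => x; apply: ord_mulrn_mod. Qed.

Lemma ord_mulrn_pow p u x : powm p u n.+1 = (1 %% n.+1)%N -> x *+ (p ^ u) = x.
Proof. by rewrite powmE => h; rewrite (ord_mulrn_mod _ h) mulr1n. Qed.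

Lemma frob_translate t f g x : frob t f = gsingle g * f -> x *+ t + g = x ->
  frob t (gsingle x * f) = gsingle x * f.
Proof. by move=> hf hx; rewrite rmorphM /= frob_single hf mulrA gsingleM hx. Qed.

Definition moment f : 'I_n.+1 := \sum_k k *~ f k.

Lemma moment_single g f : moment (gsingle g * f) = moment f + g *~ aug f.
Proof.
rewrite /moment (reindex_inj (addIr g)) /=.
under eq_bigr => k _ do rewrite gsingleMl addrK mulrzDl.
by rewrite big_split /= -mulrz_sumr.
Qed.

Lemma frobE t f k : frob t f k = \sum_(g | g *+ t == k) f g.
Proof. exact: pushE. Qed.

Lemma moment_frob t f : moment (frob t f) = moment f *+ t.
Proof.
rewrite /moment -sumrMnl [RHS](partition_big (fun k : 'I_n.+1 => k *+ t) xpredT) //=.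
apply: eq_bigr => k _; rewrite frobE mulrz_sumr.
by apply: eq_bigr => g /eqP <-; rewrite !pmulrn -!mulrzA mulrC.
Qed.

(* The moment changes by [g *~ aug A] under translation by [g], so as [aug A]
   is invertible it can be made zero, which pins down the translate. *)
Lemma fixed_translate p u A : prime p -> (p * u = 1 %[mod n.+1])%N ->
    (exists2 r, (0 < r)%N & powm p r n.+1 = 1 %% n.+1)%N ->
    A * star A = (p ^ 2)%:R ->
  exists x (e : int), [/\ e = 1 \/ e = -1, frob p ((gsingle x * A) *~ e) = (gsingle x * A) *~ e
    & aug ((gsingle x * A) *~ e) = p%:R].
Proof.
move=> pp hpu [r r0 hr] hA.
have hr' (g : 'I_n.+1) : g *+ (p ^ r) = g by apply: ord_mulrn_pow.
have [y hy] := @frob_corr_dvd_prime _ p 2 _ 1 r 1 A pp r0 hr' (esym (muln1 _)) hA.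
rewrite expn1 in hy.
have p0 : (0 < p ^ 2)%N by rewrite expn_gt0 prime_gt0.
have [g hg] := multiplier p0 hA hy.
have pK (x : 'I_n.+1) : x *+ p *+ u = x.
  by rewrite -mulrnA (ord_mulrn_mod _ hpu) mulr1n.
have [e he hea] : exists2 e : int, e = 1 \/ e = -1 & aug A = e * p%:R.
  have := aug_corr hA; rewrite natrX => /eqP; rewrite eqf_sqr => /orP[]/eqP ->.
    by exists 1; [left | rewrite mul1r].
  by exists (-1); [right | rewrite mulN1r].
have ee : e * e = 1 by case: he => ->.
(* Since aug A = e p, e e = 1 and p u = 1, the inverse of aug A modulo the order is e u. *)
pose x : 'I_n.+1 := - (moment A *~ e *+ u).
have xM : moment (gsingle x * A) = 0.
  rewrite moment_single hea /x mulNrz pmulrn -!mulrzA.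
  have -> : e * (u%:Z * (e * p%:R)) = (p * u)%N by rewrite PoszM natz; lia.
  by rewrite -pmulrn (ord_mulrn_mod _ hpu) mulr1n subrr.
have [g' hg'] : exists g', frob p (gsingle x * A) = gsingle g' * (gsingle x * A).
  exists (x *+ p + g - x); rewrite rmorphM /= frob_single hg !mulrA !gsingleM.
  by rewrite subrK.
have g0 : g' = 0.
  have := congr1 moment hg'; rewrite moment_frob (moment_single g') xM mul0rn add0r.
  rewrite augM aug_single mul1r hea => /esym h.
  have : g' *~ (e * p%:R) *~ e = 0 by rewrite h mul0rz.
  by rewrite -mulrzA mulrAC ee mul1r natz -pmulrn => h'; rewrite -(pK g') h' mul0rn.
rewrite g0 gsingle0 mul1r in hg'; exists x, e; split=> //.
  by rewrite raddfMz /= hg'.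
by rewrite augMz augM aug_single hea mul1r mulrAC ee mul1r.
Qed.

End Cyclic.

Lemma mem_range (a : int) b k : `|a| <= b%:Z -> Z_of_int a \in range b k.
Proof.
move=> h; apply/mapP; exists (absz (a + b%:Z)); first by rewrite mem_iota; lia.
lia.
Qed.

Section Feasible.
Variable n : nat.
Implicit Types f : gring 'I_n.+1.

Lemma feasible_lst t u f (ms : seq nat) T dom :
  (t * u = 1 %[mod n.+1])%N -> frob t f = f -> all (fun m => m.+1 %| n.+1)%N ms ->
  (forall k, (k < n.+1)%N -> Z_of_int (f (inZp k)) \in dom k) ->
  (forall s, (s < n.+1)%N -> Z_of_int ((f * star f) (inZp s)) = nth 0 T s) ->
  feasible t n.+1 [seq m.+1 | m <- ms] T dom [seq lst (con m f) | m <- ms] (lst f).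
Proof.
move=> htu hf hms hdom hT; split.
- exact: size_lst.
- move=> k hk; rewrite !nth_lst ?ltn_pmod // -(frob_fixE (inZp k) htu hf); congr (Z_of_int (f _)).
  by rewrite Zp_mulrn; apply: val_inj; rewrite /= modn_mod modnMml.
- by move=> k hk; rewrite nth_lst //; apply: hdom.
- move=> i j; rewrite size_map => hi.
  have -> : nth 0%N [seq m.+1 | m <- ms] i = (nth 0%N ms i).+1 by rewrite (nth_map 0%N).
  have -> : nth [::] [seq lst (con m f) | m <- ms] i = lst (con (nth 0%N ms i) f).
    by rewrite (nth_map 0%N).
  move=> hj.
  by rewrite lst_con // (all_nthP 0%N hms).
- by move=> s hs; rewrite lst_corr // hT.
Qed.

Lemma mem_lst f x : Z_of_int (f x) \in lst f.
Proof.
by apply/mapP; exists (val x); [rewrite mem_iota; exact: ltn_ord | rewrite valZpK].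
Qed.

Lemma lst0 : lst (0 : gring 'I_n.+1) = nseq n.+1 0.
Proof.
apply: (@eq_from_nth _ 0); first by rewrite size_lst size_nseq.
by move=> i; rewrite size_lst => hi; rewrite nth_lst // gring0 nth_nseq hi.
Qed.

Lemma lst_con0 f : lst (con 0 f) = [:: Z_of_int (aug f)].
Proof.
congr [:: Z_of_int _]; rewrite conE; apply: eq_bigl => g.
by rewrite [red _ _]ord1 [inZp _]ord1.
Qed.

Lemma nth_single (k s : nat) : (s < n.+1)%N ->
  Z_of_int ((k%:R : gring 'I_n.+1) (inZp s)) = nth 0 (single n.+1 (Z.of_nat k)) s.
Proof.
move=> hs; rewrite gringMn -gsingle0 gsingleE /single -val_eqE /= modn_small //.
by case: s hs => [|s] hs /=; rewrite ?nth_nseq ?mul0rn ?natz //; case: ifP.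
Qed.

Lemma nth_anti (k s : nat) : ~~ odd n.+1 -> (s < n.+1)%N ->
  let h : 'I_n.+1 := inZp n.+1./2 in
  Z_of_int ((k%:R * ((1 - gsingle h) * star (1 - gsingle h))) (inZp s)) =
  nth 0 (anti n.+1 (Z.of_nat k)) s.
Proof.
move=> hn hs h; have hh : h + h = 0.
  by apply: val_inj; rewrite /= modnDm addnn -[X in X.*2]/(n.+1./2) even_halfK // modnn.
have nh : - h = h by apply/eqP; rewrite eq_sym -subr_eq0 opprK hh.
have -> : k%:R * ((1 - gsingle h) * star (1 - gsingle h)) = (1 - gsingle h) *+ (2 * k).
  have HH : gsingle h * gsingle h = 1 by rewrite gsingleM hh gsingle0.
  have E : (1 - gsingle h) * (1 - gsingle h) = (1 - gsingle h) *+ 2.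
    have -> : (1 - gsingle h) * (1 - gsingle h) = 1 - gsingle h *+ 2 + gsingle h * gsingle h.
      by ring.
    by rewrite HH; ring.
  by rewrite rmorphB rmorph1 /= star_single nh E mulrnAr mulr_natl -mulrnA mulnC.
have hv : (n.+1./2 < n.+1)%N by rewrite -divn2 ltn_Pdiv.
have hval : val h = n.+1./2 by rewrite /h; exact: modn_small.
have sval : val (inZp s : 'I_n.+1) = s by exact: modn_small.
rewrite gringMn gaddE gringN -gsingle0 !gsingleE -!val_eqE hval sval.
rewrite /anti (nth_map 0%N) ?size_iota // nth_iota // add0n.
have h0 : n.+1./2 != 0%N by case: (n) hn.
case: (eqVneq s 0%N) => [->|s0]; first by rewrite eq_sym (negbTE h0); lia.
by case: eqP => _; lia.
Qed.

End Feasible.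

(** * Weight 36 *)

(** The relation 9 - 8 = 1 joins divisibility by 4 with divisibility by 9. *)
Lemma dvd36 (S : comNzRingType) (z y1 y2 : S) :
  z = (2 ^ 2)%:R * y1 -> z = (3 ^ 2)%:R * y2 -> z = 36%:R * (y1 - 2%:R * y2).
Proof.
move=> h1 h2; have -> : z = 9%:R * z - 8%:R * z by ring.
by rewrite {1}h1 h2 !natrX; ring.
Qed.

Lemma icw7P (B : gring 'I_7) : (forall g, `|B g| <= 20) -> frob 4 B = B ->
  B * star B = 36%:R -> lst B \in icw7.
Proof.
move=> hb hf hB.
have [a ha hBa] : exists2 a, a \in [:: Z_of_int 6; Z_of_int (-6)] & lst (con 0 B) = [:: a].
  have hs : aug B = 6 \/ aug B = -6.
    by have := aug_corr hB; move: (aug B) => a ha; nia.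
  rewrite lst_con0.
  by case: hs => ->; [exists (Z_of_int 6)|exists (Z_of_int (-6))].
have st : stage_ok 4 7 1 [:: 1%N] (single 7 (Z.of_nat 36)) by vm_compute.
apply: (solveP st ha); rewrite -hBa.
apply: (@feasible_lst 6 4 2 B [:: 0%N]) => //.
- by move=> k hk; apply: mem_range.
- by move=> s hs; rewrite hB; exact: (@nth_single 6 36 s).
Qed.

Lemma icw35P_fixed (B : gring 'I_35) : (forall g, `|B g| <= 4) -> frob 4 B = B ->
  B * star B = 36%:R -> lst B \in icw35.
Proof.
move=> hb hf hB.
have hB7 : lst (con 6 B) \in icw7.
  apply: icw7P.
  - by move=> g; have := @con_bound 34 6 isT _ _ hb g.
  - by rewrite -con_frob // hf.
  - by rewrite -con_star // -conM // hB con_nat.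
have st : stage_ok 4 35 7 [:: 7%N] (single 35 (Z.of_nat 36)) by vm_compute.
apply: (solveP st hB7).
apply: (@feasible_lst 34 4 9 B [:: 6%N]); [by []|exact: hf|by []| |].
- by move=> k hk; apply: mem_range.
- by move=> s hs; rewrite hB; exact: (@nth_single 34 36 s).
Qed.

Lemma icw35P (B : gring 'I_35) : (forall g, `|B g| <= 4) -> B * star B = 36%:R ->
  forall g, B g \in [:: 0; 3; -3].
Proof.
move=> hb hB.
have [g hg] : exists g, frob 4 B = gsingle g * B.
  (* Modulo 35 both 2^2 and 3^10 are 4, so the primes 2 and 3 speak about the same [frob 4]. Both
     have order 12 there. *)
  have [y1 hy1] : exists y, frob (2 ^ 2) B * star B = (2 ^ 2)%:R * y.
    apply: (@frob_corr_dvd_prime _ 2 2 36 9 12 2 B _ _ _ _ hB) => // x.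
    exact: ord_mulrn_pow.
  have [y2 hy2] : exists y, frob (3 ^ 10) B * star B = (3 ^ 2)%:R * y.
    apply: (@frob_corr_dvd_prime _ 3 2 36 4 12 10 B _ _ _ _ hB) => // x.
    exact: ord_mulrn_pow.
  rewrite (@frob_mod _ _ 4) in hy2; last by rewrite -powmE.
  apply: (@multiplier _ B 36 4 (y1 - 2%:R * y2)) => //.
  by apply: dvd36 => //; rewrite hy2.
(* 23 is the inverse of -3 modulo 35, so x = 23 g solves 4 x + g = x. *)
pose B' := gsingle (g *+ 23) * B.
have hB' : frob 4 B' = B'.
  apply: frob_translate hg _; rewrite -mulrnA -mulrSr.
  exact: ord_mulrn_mod.
have cB' : B' * star B' = 36%:R by rewrite /B' corr_single.
have bB' x : `|B' x| <= 4 by rewrite gsingleMl.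
move=> x; have /allP /(_ _ (icw35P_fixed bB' hB' cB')) := icw35_values.
move=> /allP /(_ (Z_of_int (B' (x + g *+ 23)))).
rewrite mem_lst gsingleMl addrK.
by move=> /(_ isT); rewrite !inE; move: (B x) => b; lia.
Qed.

(* Twisting by the character of order 2 preserves the correlation, so the image
   S in C_70 and its twist both have sums in {0, 3, -3} over the cosets of 35;
   as |S| <= 2, this forces S = 0. *)
Section Twist.
Variable n : nat.
Hypothesis n_even : ~~ odd n.+1.

Definition twist (f : gring 'I_n.+1) : gring 'I_n.+1 := [ffun k : 'I_n.+1 => (-1) ^+ odd k * f k].

Lemma twistE f k : twist f k = (-1) ^+ odd k * f k.
Proof. by rewrite ffunE. Qed.

Lemma odd_ordB (k i : 'I_n.+1) : odd (k - i)%R = odd k (+) odd i.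
Proof.
have hm m : odd (m %% n.+1) = odd m.
  by rewrite [in RHS](divn_eq m n.+1) oddD oddM (negbTE n_even) andbF.
rewrite -[nat_of_ord (k - i)%R]/((k + (n.+1 - i) %% n.+1) %% n.+1)%N.
by rewrite hm oddD hm oddB ?(negbTE n_even) // ltnW.
Qed.

Lemma twistM f g : twist (f * g) = twist f * twist g.
Proof.
apply: gringP => k; rewrite twistE !gringM mulr_sumr; apply: eq_bigr => i _.
rewrite !twistE odd_ordB signr_addb.
by case: (odd k); case: (odd i); rewrite ?expr1 ?expr0; ring.
Qed.

Lemma twist_star f : twist (star f) = star (twist f).
Proof.
apply: gringP => k; rewrite twistE !starE twistE; congr (_ ^+ _ * _).
by rewrite -[- k]sub0r odd_ordB.
Qed.

Lemma twist_nat k : twist k%:R = k%:R.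
Proof.
apply: gringP => g; rewrite twistE gringMn -gsingle0 gsingleE.
by case: eqP => [->|_]; rewrite ?expr0 ?mul1r // mul0rn mulr0.
Qed.

Lemma twist_norm f k : `|twist f k| = `|f k|.
Proof. by rewrite twistE normrM normrX normrN1 expr1n mul1r. Qed.

End Twist.

Lemma con_half (w : nat) (f : gring 'I_(w.*2.+2)) (k : 'I_(w.*2.+2)) :
  con w f (inZp k) = f k + f (k + inZp w.+1).
Proof.
set h : 'I_(w.*2.+2) := inZp w.+1.
have hv : (h : nat) = w.+1 by rewrite /h /=; apply: modn_small; rewrite -doubleS; lia.
have kh : (k + h)%R = (if (k <= w)%N then k + w.+1 else k - w.+1)%N :> nat.
  rewrite -[nat_of_ord _]/((k + h) %% w.*2.+2)%N hv; have hk' := ltn_ord k.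
  case: (leqP k w) => hk; first by rewrite modn_small; lia.
  have -> : (k + w.+1 = (k - w.+1) + w.*2.+2)%N by lia.
  by rewrite modnDr modn_small; lia.
have hne : k + h != k.
  apply/eqP => /(congr1 (@nat_of_ord _)); rewrite kh; have := ltn_ord k.
  by case: (leqP k w) => hk hk'; lia.
have redE (x : 'I_(w.*2.+2)) : (red w x : nat) = (x %% w.+1)%N by [].
rewrite conE (bigD1 k) //= (bigD1 (k + h)) /=; last first.
  rewrite hne andbT; apply/eqP/ord_inj; rewrite !redE kh; case: (leqP k w) => hk.
    by rewrite modnDr.
  by rewrite -[in RHS](subnK hk) modnDr.
rewrite big1 ?addr0 // => i /andP[/andP[/eqP /(congr1 (@nat_of_ord _))]].
rewrite !redE => him /eqP hik /eqP hikh; exfalso.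
have {}hik : (i : nat) <> k by move=> e; apply: hik; apply: ord_inj.
have {}hikh : (i : nat) <> (k + h)%R by move=> e; apply: hikh; apply: ord_inj.
have := ltn_ord i; have := ltn_ord k => hk hi.
have e1 := divn_eq i w.+1; have e2 := divn_eq k w.+1; rewrite him in e1.
have r := ltn_pmod k (ltn0Sn w).
have q1 : (i %/ w.+1 < 2)%N by rewrite ltn_divLR //; lia.
have q2 : (k %/ w.+1 < 2)%N by rewrite ltn_divLR //; lia.
rewrite kh in hikh; move: e1 e2 q1 q2 hikh hik r.
move: (i %/ w.+1)%N (k %/ w.+1)%N (k %% w.+1)%N.
move=> a b r; move: (nat_of_ord i) (nat_of_ord k) => i0 k0 e1 e2 q1 q2 hikh hik hr.
by case: (leqP k0 w) hikh => hk0 hikh; case: a e1 q1 => [|[|?]] e1 q1; case: b e2 q2 => [|[|?]] e2 q2; lia.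
Qed.

Lemma no_CW_140_36 (A : gring 'I_140) : (forall g, `|A g| <= 1) ->
  A * star A = 36%:R -> False.
Proof.
move=> hb hA; pose S := con 69 A.
have hS : S * star S = 36%:R by rewrite /S -con_star // -conM // hA con_nat.
have bS g : `|S g| <= 2 by have := @con_bound 139 69 isT _ _ hb g.
have hv (f : gring 'I_70) : (forall g, `|f g| <= 2) -> f * star f = 36%:R ->
    forall k, f k + f (k + inZp 35) \in [:: 0; 3; -3].
  move=> bf hf k; suff : con 34 f (inZp k) \in [:: 0; 3; -3].
    by move=> h; rewrite -(@con_half 34 f k : con 34 f (inZp k) = f k + f (k + inZp 35)).
  apply: icw35P; first by move=> g; have := @con_bound 69 34 isT _ _ bf g.
  by rewrite -con_star // -conM // hf con_nat.
have S0 : S = 0.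
  apply: gringP => k; rewrite gring0.
  have h1 := hv S bS hS k.
  have h2 : twist S k + twist S (k + inZp 35) \in [:: 0; 3; -3].
    apply: hv; first by move=> g; rewrite twist_norm.
    by rewrite -twist_star // -twistM // hS twist_nat.
  have e : odd (k + inZp 35 : 'I_70)%R = ~~ odd k.
    rewrite -[k + _]opprK -[- _]sub0r odd_ordB // opprD -[- k]sub0r.
    by rewrite !odd_ordB //= addbT.
  (* As 35 is odd, the twist turns the sum a + b into a - b up to sign. The two have equal parity,
     so both are 0 or both are 3 up to sign; the latter would make a or b equal to 3 up to sign. *)
  rewrite !twistE e !inE in h1 h2.
  move: h1 h2 (bS k) (bS (k + inZp 35)); move: (S k) (S (k + inZp 35)) => a b.
  by case: (odd k) => /=; rewrite ?expr1 ?expr0; lia.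
by move: (congr1 (fun f : gring 'I_70 => f 0) hS); rewrite S0 mul0r gring0 gringMn -gsingle0 gsingleE eqxx.
Qed.

(** * Order 105: the characters of order 3 *)

Definition norm3 n (u : 'I_n.+1) : gring 'I_n.+1 := 1 + gsingle u + gsingle (u + u).

Lemma nth_corr3 n w (k s : nat) : n.+1 = (3 * w)%N -> (s < n.+1)%N ->
  let u : 'I_n.+1 := inZp w in
  Z_of_int (((3 * k)%:R - k%:R * norm3 u) (inZp s)) = nth 0 (corr3 n.+1 (Z.of_nat k)) s.
Proof.
move=> hn hs u; have w0 : (0 < w)%N by lia.
have uv : val u = w by rewrite /u; apply: modn_small; lia.
have uuv : val (u + u) = (2 * w)%N.
  by rewrite /u; apply: etrans (modnDm _ _ _) _; rewrite modn_small; lia.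
have sv : val (inZp s : 'I_n.+1) = s by exact: modn_small.
have zv : val (0 : 'I_n.+1) = 0%N by [].
rewrite gaddE gringN mulr_natl !gringMn /norm3 !gaddE -gsingle0 !gsingleE.
rewrite -!val_eqE zv uv uuv sv /corr3 (nth_map 0%N) ?size_iota // nth_iota // add0n.
have -> : (n.+1 %/ 3 = w)%N by rewrite hn; lia.
case: (eqVneq s 0%N) => [->|s0]; first by rewrite !eqn_leq; lia.
by case: (eqVneq s w) => [->|sw]; case: eqP => /= [|_]; lia.
Qed.

Lemma con_norm3 n m (u : 'I_n.+1) : (m.+1 %| n.+1)%N ->
  con m (norm3 u) = norm3 (inZp u).
Proof.
move=> mn; rewrite /norm3 !(raddfD (con m)) /= con1 // !con_single.
by congr (_ + _ + gsingle _); apply: redD.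
Qed.

Lemma con_corr n m (f x : gring 'I_n.+1) : (m.+1 %| n.+1)%N ->
  f * star f = x -> con m f * star (con m f) = con m x.
Proof. by move=> mn <-; rewrite conM // con_star. Qed.

Lemma con_corr3 n m (u : 'I_n.+1) j k : (m.+1 %| n.+1)%N ->
  con m (j%:R - k%:R * norm3 u) = j%:R - k%:R * norm3 (inZp u).
Proof. by move=> mn; rewrite (raddfB (con m)) /= conM // !con_nat // con_norm3. Qed.

Lemma cw105_15P (C : gring 'I_15) : (forall g, `|C g| <= 7) -> frob 4 C = C ->
  C * star C = 36%:R - 12%:R * norm3 (inZp 5) -> con 4 C = 0 -> lst C \in cw105_15.
Proof.
move=> hb hf hC h0.
have st : stage_ok 4 15 5 [:: 5%N] (corr3 15 (Z.of_nat 12)) by vm_compute.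
apply: (solveP st (mem_head _ _)).
have -> : [:: nseq 5 Z0] = [seq lst (con m C) | m <- [:: 4%N]] by rewrite /= h0 lst0.
apply: (@feasible_lst 14 4 4 C [:: 4%N]); [by []|exact: hf|by []| |].
- by move=> k hk; apply: mem_range.
- by move=> s hs; rewrite hC; exact: (@nth_corr3 14 5 12 s).
Qed.

Lemma cw105P (C : gring 'I_105) : (forall g, `|C g| <= 1) -> frob 4 C = C ->
  C * star C = 36%:R - 12%:R * norm3 (inZp 35) -> con 34 C = 0 -> False.
Proof.
move=> hb hf hC h0.
have h15 : lst (con 14 C) \in cw105_15.
  apply: cw105_15P.
  - by move=> g; have := @con_bound 104 14 isT _ _ hb g.
  - by rewrite -con_frob // hf.
  - rewrite (@con_corr 104 14 _ _ isT hC) (@con_corr3 104 14 _ 36 12 isT).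
    by congr (_ - _ * norm3 _); apply: val_inj.
  - by rewrite con_con; [rewrite -(@con_con 104 4 34 C isT) h0 raddf0|].
have st : stage_ok 4 105 5 [:: 35%N; 15%N] (corr3 105 (Z.of_nat 12)) by vm_compute.
suff : lst C \in cw105 by rewrite cw105_nil.
apply: (solveP st h15).
have -> : [:: nseq 35 Z0; lst (con 14 C)] = [seq lst (con m C) | m <- [:: 34%N; 14%N]].
  by rewrite /= h0 lst0.
apply: (@feasible_lst 104 4 79 C [:: 34%N; 14%N]); [by []|exact: hf|by []| |].
- by move=> k hk; apply: mem_range.
- by move=> s hs; rewrite hC; exact: (@nth_corr3 104 35 12 s).
Qed.

Lemma dvd36_rel (S : comNzRingType) (z y1 y2 c : S) :
  z = (2 ^ 2)%:R * y1 -> z * c = 9%:R * y2 * c -> z * c = 36%:R * (y1 - 2%:R * y2) * c.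
Proof.
move=> h1 h2; have -> : z * c = 9%:R * z * c - 8%:R * (z * c) by ring.
by rewrite h2 h1 !natrX; ring.
Qed.

Lemma dvc_single (G : finZmodType) (u : G) (c : gring G) g k :
  dvc (1 - gsingle u) c 1 (gsingle (g + u *+ k) - gsingle g).
Proof.
exists (- gsingle g * \sum_(i < k) gsingle u ^+ i).
have -> : gsingle (g + u *+ k) - gsingle g = gsingle g * (gsingle u ^+ k - 1).
  by rewrite gsingleX mulrBr gsingleM mulr1.
by rewrite subrX1 expr1; ring.
Qed.

Lemma dvc_mulrn (G : finZmodType) (u : G) (c : gring G) p t :
  (forall g, exists k, g *+ t = g *+ p + u *+ k) ->
  forall g, dvc (1 - gsingle u) c 1 (gsingle (g *+ t) - gsingle (g *+ p)).
Proof. by move=> h g; have [k ->] := h g; apply: dvc_single. Qed.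

(** The characters that c does not annihilate send u to a primitive cube root of unity z, and (1 -
    z)^2 = - 3 z. Relative to c, therefore, 9 is associate to (1 - [u])^4, while the prime 2 is
    treated absolutely. *)
Lemma frob_rel3 (G : finZmodType) (u : G) t r j (A : gring G) :
  u != 0 -> u *+ 3 = 0 -> (0 < r)%N -> (forall g : G, g *+ (2 ^ r) = g) ->
  (forall g : G, g *+ (t ^ r) = g) -> (forall g : G, g *+ (t ^ j) = g *+ 4) ->
  u *+ t = u -> (forall g : G, exists k, g *+ t = g *+ 3 + u *+ k) ->
  A * star A = 36%:R ->
  let c := 1 - gsingle u in frob 4 c = c ->
  exists g (e : int), (e = 1 \/ e = -1) /\ frob 4 (A * c) = (gsingle g * (A * c)) *~ e.
Proof.
move=> u0 u3 r0 h2r htr htj ut htk hA c hc; pose U := gsingle u.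
have U3 : U ^+ 3 = 1 by rewrite gsingleX u3 gsingle0.
have cc : (1 - U) ^+ 2 * c = - 3%:R * U * c.
  have -> : (1 - U) ^+ 2 * c = - 3%:R * U * c + (1 - U ^+ 3) by rewrite /c -/U; ring.
  by rewrite U3 subrr addr0.
have tU : frob t (1 - U) = 1 - U by rewrite rmorphB rmorph1 /= frob_single ut.
have [y1 hy1] : exists y, frob (2 ^ 2) A * star A = (2 ^ 2)%:R * y.
  exact: (@frob_corr_dvd_prime _ 2 2 36 9 r 2 A isT r0 h2r erefl hA).
have [y2 hy2] : exists y, frob (t ^ j) A * star A * c = 9%:R * y * c.
  apply: (@frob_corr_dvd _ 3 t 4 36 9 4 r (1 - U) c j A (U ^+ 2) isT r0 htr _ tU tU _ _ _ hA) => //.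
  - exists (- U ^+ 2 * (1 - U)).
    have -> : (1 - U) ^+ 1 * (- U ^+ 2 * (1 - U)) * c = - U ^+ 2 * ((1 - U) ^+ 2 * c) by ring.
    by rewrite cc (_ : _ * (_ * c) = 3%:R * U ^+ 3 * c); [rewrite U3 mulr1 | ring].
  - exact: dvc_mulrn.
  - rewrite (_ : (1 - U) ^+ 4 * c = (1 - U) ^+ 2 * ((1 - U) ^+ 2 * c)); last by ring.
    rewrite cc (_ : _ * _ = - 3%:R * U * ((1 - U) ^+ 2 * c)); last by ring.
    by rewrite cc; ring.
have h4 : frob (t ^ j) A = frob 4 A by apply: eq_push.
rewrite h4 in hy2; have hz := dvd36_rel hy1 hy2.
apply: (multiplier_rel _ hA hc hz) => // z.
exact: unit_rel3.
Qed.

(** As 4 = 1 modulo 3, the image X in Z[C_3] satisfies X = e [g] X. Three iterations give X = e^3 X,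
    so e = 1. If g were nonzero modulo 3, X would be translation invariant, whence 3 X = N X = 0.
    That 3 divides g makes 4 x + g = x solvable. *)
Lemma shift3_con (n : nat) (f : gring 'I_n.+1) g (e : int) k :
  n.+1 = (3 * k)%N -> e = 1 \/ e = -1 -> con 2 f != 0 -> norm3 (1 : 'I_3) * con 2 f = 0 ->
  frob 4 f = (gsingle g * f) *~ e -> e = 1 /\ (3 %| g)%N.
Proof.
move=> hn he X0 hN hf; set X := con 2 f in X0 hN.
have mn : (3 %| n.+1)%N by rewrite hn dvdn_mulr.
have hX : X = (gsingle (red 2 g) * X) *~ e.
  have : con 2 (frob 4 f) = con 2 ((gsingle g * f) *~ e) by rewrite hf.
  rewrite con_frob // raddfMz /= conM // con_single // -/X => <-.
  rewrite (@frob_mod _ _ 1) //; symmetry; apply: push_id => x.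
  by rewrite mulr1n.
have e1 : e = 1.
  case: he => // he; rewrite he mulrN1z in hX.
  have h3 : X = - X.
    rewrite {1}hX {1}hX {1}hX !mulrN opprK !mulrA !gsingleM.
    rewrite (_ : red 2 g + red 2 g + red 2 g = 0) ?gsingle0 ?mul1r //.
    by case: (red 2 g) => [[|[|[|m]]] hm] //; apply: val_inj.
  exfalso; move/negP: X0; apply; apply/eqP/gringP => x.
  by have := congr1 (fun f : gring 'I_3 => f x) h3; rewrite gringN gring0; lia.
split=> //; rewrite e1 mulr1z in hX.
case: (eqVneq (red 2 g) 0) => [/(congr1 val) /= h|hg]; first by rewrite /dvdn h.
have {}hN : X *+ 3 = 0.
  rewrite -hN /norm3 !mulrDl mul1r.
  have hX2 : X = gsingle (red 2 g + red 2 g) * X by rewrite -gsingleM -mulrA -!hX.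
  have [hr|hr] : red 2 g = 1 \/ red 2 g = 1 + 1.
    case: (red 2 g) hg => [[|[|[|m]]] hm] // _; [left | right]; exact: val_inj.
  - by rewrite hr in hX hX2; rewrite -hX -hX2 -mulr2n -mulrSr.
  - have h11 : red 2 g + red 2 g = 1 by rewrite hr; apply: val_inj.
    rewrite h11 in hX2; rewrite hr in hX.
    by rewrite -hX -hX2 -mulr2n -mulrSr.
exfalso; move/negP: X0; apply; apply/eqP/gringP => x.
by have := congr1 (fun f : gring 'I_3 => f x) hN; rewrite gringMn gring0; lia.
Qed.

Section Norm3.
Variables (n : nat) (u : 'I_n.+1).
Hypothesis u3 : u *+ 3 = 0.
Let U := gsingle u.
Let N := norm3 u.

Lemma norm3E : N = 1 + U + U ^+ 2.
Proof. by rewrite /N /norm3 gsingleX mulr2n. Qed.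

Lemma gsingle_cube : U ^+ 3 = 1.
Proof. by rewrite gsingleX u3 gsingle0. Qed.

Lemma star_norm3 : star N = N.
Proof.
have nu : - u = u + u.
  by apply/eqP; rewrite eq_sym -subr_eq0 opprK -u3 !mulrS mulr0n addr0 addrA.
rewrite /N /norm3 !(raddfD (@star _)) /= rmorph1 !star_single opprD nu.
have -> : u + u + (u + u) = u + u *+ 3 by rewrite !mulrS mulr0n addr0 !addrA.
by rewrite u3 addr0 addrAC.
Qed.

Lemma norm3_sqr : N * N = 3%:R * N.
Proof.
have -> : N * N = 3%:R * N + (U ^+ 3 - 1) * (2%:R + U) by rewrite norm3E; ring.
by rewrite gsingle_cube subrr mul0r addr0.
Qed.

(** Through this factorisation A (3 - N) inherits invariance under [frob 4] from A (1 - [u]). *)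
Lemma norm3_factor : 3%:R - N = (1 - U) * (2%:R + U).
Proof. by rewrite norm3E; ring. Qed.

Lemma norm3_kernel : N * (1 - U) = 0.
Proof.
have -> : N * (1 - U) = 1 - U ^+ 3 by rewrite norm3E; ring.
by rewrite gsingle_cube subrr.
Qed.

Lemma norm3_poly (S : comNzRingType) (x : S) : x * x = 3%:R * x ->
  36%:R * ((3%:R - x) * (3%:R - x)) = 9%:R * (36%:R - 12%:R * x).
Proof.
move=> h; have -> : 36%:R * ((3%:R - x) * (3%:R - x)) = 36%:R * (9%:R - 6%:R * x + x * x).
  by ring.
by rewrite h; ring.
Qed.

Lemma corr_norm3 A : A * star A = 36%:R ->
  (A * (3%:R - N)) * star (A * (3%:R - N)) = 9%:R * (36%:R - 12%:R * N).
Proof.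
move=> hA; rewrite rmorphM rmorphB rmorph_nat /= star_norm3 mulrACA hA.
exact: norm3_poly norm3_sqr.
Qed.

Lemma norm3Ml f k : (N * f) k = f k + f (k - u) + f (k - (u + u)).
Proof. by rewrite /N /norm3 !mulrDl mul1r !gaddE !gsingleMl. Qed.

End Norm3.

Lemma con34_norm3 (f : gring 'I_105) (k : 'I_105) : con 34 f (inZp k) = (norm3 (inZp 35) * f) k.
Proof.
rewrite norm3Ml conE (reindex_inj (subrI k)) /=.
set u : 'I_105 := inZp 35.
rewrite (bigD1 0) /=; last by rewrite subr0.
rewrite (bigD1 u) /=; last first.
  rewrite redD // redN // (_ : red 34 u = 0) ?subr0 ?eqxx //.
  by apply: val_inj.
rewrite (bigD1 (u + u)) /=; last first.
  by rewrite redD // redN // (_ : red 34 (u + u) = 0) ?subr0 ?eqxx //; apply: val_inj.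
rewrite subr0 addrA big1 ?addr0 // => i /andP[/andP[/andP[hi i0] iu] iuu]; exfalso.
move: hi; rewrite redD // -subr_eq0 addrAC subrr add0r redN // oppr_eq0.
move=> /eqP /(congr1 val) /= hi.
have {}i0 : (i : nat) <> 0%N by move=> e; move/eqP: i0; apply; apply: ord_inj.
have {}iu : (i : nat) <> 35 by move=> e; move/eqP: iu; apply; apply: ord_inj.
have {}iuu : (i : nat) <> 70 by move=> e; move/eqP: iuu; apply; apply: ord_inj.
by have := ltn_ord i; move: hi i0 iu iuu; move: (nat_of_ord i) => j; lia.
Qed.

Section NoCW105.
Variable A : gring 'I_105.
Hypothesis A_le1 : forall g, `|A g| <= 1.
Hypothesis A_corr : A * star A = 36%:R.
Let u : 'I_105 := inZp 35.
Hypothesis A_fix : frob 4 (A * (1 - gsingle u)) = A * (1 - gsingle u).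

Fact u_cube : u *+ 3 = 0. Proof. exact: val_inj. Qed.

Let B := con 34 A.

(** Cosets of three elements give the bound 3, within the bound 4 of the search shared with order
    140. *)
Lemma B_values g : B g \in [:: 0; 3; -3].
Proof.
apply: icw35P; last by rewrite (con_corr (m := 34) _ A_corr) ?con_nat.
move=> j; have := @con_bound 104 34 isT _ _ A_le1 j.
by move=> /le_trans; apply.
Qed.

(* The sums of [A] over the cosets of [u] are 0 or +-3, so all terms in a coset
   with nonzero sum are equal, which makes A (3 - [norm3 u]) divisible by 3. *)
Let C : gring 'I_105 := [ffun k : 'I_105 => if B (inZp k) == 0 then A k else 0].

Lemma C_E : A * (3%:R - norm3 u) = 3%:R * C.
Proof.
apply: gringP => k; rewrite mulrBr gaddE gringN [A * norm3 u]mulrC.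
rewrite -con34_norm3 -/B ![_ * 3%:R]mulrC !mulr_natl !gringMn [C k]ffunE.
have := B_values (inZp k); case: eqP => [-> _|B0]; first by rewrite subr0.
have := con34_norm3 A k; rewrite -/B norm3Ml => hB; rewrite !inE hB.
move: B0 (A_le1 k) (A_le1 (k - inZp 35)) (A_le1 (k - (inZp 35 + inZp 35))).
rewrite hB; move: (A k) (A _) (A _) => a b c; rewrite mul0rn; lia.
Qed.

Lemma no_CW_105_36_fixed : False.
Proof.
apply: (@cw105P C).
- by move=> g; rewrite ffunE; case: ifP => // _; rewrite normr0.
- apply: (@gring_natI _ 3) => //; rewrite -C_E norm3_factor ?u_cube //.
  have -> : 3%:R * frob 4 C = frob 4 (3%:R * C) by rewrite rmorphM rmorph_nat.
  rewrite -C_E norm3_factor ?u_cube // mulrA (rmorphM (frob 4)) /= A_fix; congr (_ * _).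
  by rewrite rmorphD rmorph_nat /= frob_single; congr (_ + gsingle _); apply: val_inj.
- apply: (@gring_natI _ 9) => //; rewrite -(corr_norm3 u_cube A_corr) C_E.
  by rewrite rmorphM rmorph_nat /=; ring.
- apply: (@gring_natI _ 3) => //; rewrite mulr0.
  have -> : 3%:R * con 34 C = con 34 (3%:R * C) by rewrite conM ?con_nat.
  rewrite -C_E conM // (raddfB (con 34)) /= con_nat // con_norm3 //.
  rewrite (_ : inZp u = 0); last exact: val_inj.
  by rewrite /norm3 addr0 gsingle0 (_ : 3%:R - _ = 0) ?mulr0 //; ring.
Qed.

End NoCW105.

Lemma frob105 (A : gring 'I_105) : A * star A = 36%:R ->
  exists g (e : int), (e = 1 \/ e = -1) /\
    frob 4 (A * (1 - gsingle (inZp 35))) =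
    (gsingle g * (A * (1 - gsingle (inZp 35)))) *~ e.
Proof.
(* 73 is 3 modulo 35 and 1 modulo 3. *)
move=> hA; apply: (@frob_rel3 _ (inZp 35) 73 12 10) hA _; first by [].
- exact: u_cube.
- by [].
- by move=> g; apply: ord_mulrn_pow.
- by move=> g; apply: ord_mulrn_pow.
(* 73^10 is 3^10 = 4 modulo 35 and 1 modulo 3, hence 4 modulo 105. *)
- by move=> g; apply: ord_mulrn_mod; rewrite -powmE.
- exact: val_inj.
- move=> g; exists (2 * g)%N; have -> : g *+ 73 = g *+ 3 + g *+ 70 by rewrite -mulrnDr.
  congr (_ + _).
  rewrite !Zp_mulrn; congr inZp; rewrite -[nat_of_ord (inZp 35)]/35%N; lia.
- by rewrite rmorphB rmorph1 /= frob_single; congr (_ - gsingle _); apply: val_inj.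
Qed.

Lemma no_CW_105_36 (A : gring 'I_105) : (forall g, `|A g| <= 1) ->
  A * star A = 36%:R -> False.
Proof.
move=> hb hA; pose c : gring 'I_105 := 1 - gsingle (inZp 35).
have [g [e [he hf]]] := frob105 hA.
have cE : con 2 c = 1 - gsingle (inZp 35).
  by rewrite (raddfB (con 2)) /= con1 // con_single; congr (_ - gsingle _); apply: val_inj.
(* The image has correlation 36 c c^*, which is nonzero in Z[C_3]. *)
have X0 : con 2 (A * c) != 0.
  apply/eqP => h.
  have : con 2 (A * star A) * (con 2 c * star (con 2 c)) = 0.
    by rewrite conM // con_star // mulrACA -(conM (m := 2)) // h mul0r.
  rewrite hA con_nat // cE mulr_natl => /(congr1 (fun f : gring 'I_3 => f 0)).
  rewrite gringMn corr0E !big_ord_recl big_ord0 !gaddE !gringN -!gsingle0 !gsingleE.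
  by rewrite gring0.
have XN : norm3 (1 : 'I_3) * con 2 (A * c) = 0.
  rewrite conM // cE mulrCA (_ : norm3 1 * _ = 0) ?mulr0 //.
  have -> : norm3 (1 : 'I_3) = norm3 (inZp 35).
    rewrite /norm3 addrAC; congr (1 + gsingle _ + gsingle _); exact: val_inj.
  by apply: norm3_kernel; apply: val_inj.
have [e1 hg] := @shift3_con 104 (A * c) g e 35 erefl he X0 XN hf.
rewrite e1 mulr1z -/c in hf.
(* The solution x = - g / 3 of 4 x + g = x. *)
pose x : 'I_105 := - inZp (g %/ 3).
have hx : x *+ 4 + g = x.
  have -> : g = inZp (g %/ 3) *+ 3.
    by rewrite Zp_mulrn; apply: val_inj; rewrite /= modnMml divnK // modn_small.
  rewrite /x; set y := inZp _; rewrite !mulNrn; apply/eqP.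
  by rewrite eq_sym -subr_eq0 opprD opprK -addrA -mulNrn; apply/eqP; ring.
apply: (@no_CW_105_36_fixed (gsingle x * A)).
- by move=> j; rewrite gsingleMl.
- by rewrite corr_single.
- by rewrite -mulrA; apply: frob_translate hf hx.
Qed.

(** * Weight 64 *)

(** The characters that c does not annihilate send u to a square root i of -1, and (1 - i)^2 = - 2
    i. Relative to c, therefore, 64 is associate to (1 - [u])^12. *)
Lemma frob_rel4 (G : finZmodType) (u : G) t r (A : gring G) :
  u + u != 0 -> u *+ 4 = 0 -> (0 < r)%N -> (forall g : G, g *+ (t ^ r) = g) ->
  u *+ t = u -> (forall g : G, exists k, g *+ t = g *+ 2 + u *+ k) ->
  A * star A = 64%:R ->
  let c := 1 - gsingle (u + u) in
  exists g (e : int), (e = 1 \/ e = -1) /\ frob t (A * c) = (gsingle g * (A * c)) *~ e.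
Proof.
move=> u0 u4 r0 htr ut htk hA c; pose U := gsingle u.
have U4 : U ^+ 4 = 1 by rewrite gsingleX u4 gsingle0.
have cE : c = 1 - U ^+ 2 by rewrite /c gsingleX mulr2n.
have cc : (1 - U) ^+ 2 * c = - 2%:R * U * c.
  have -> : (1 - U) ^+ 2 * c = - 2%:R * U * c + (1 - U ^+ 4) by rewrite cE; ring.
  by rewrite U4 subrr addr0.
have tU : frob t (1 - U) = 1 - U by rewrite rmorphB rmorph1 /= frob_single ut.
have tc : frob t c = c by rewrite /c rmorphB rmorph1 /= frob_single mulrnDl ut.
have [y hy] : exists y, frob (t ^ 1) A * star A * c = 64%:R * y * c.
  apply: (@frob_corr_dvd _ 2 t 12 64 64 1 r (1 - U) c 1 A (U ^+ 6) isT r0 htr _ tU tc _ erefl _ hA).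
  - exists (- U ^+ 3 * (1 - U)).
    have -> : (1 - U) ^+ 1 * (- U ^+ 3 * (1 - U)) * c = - U ^+ 3 * ((1 - U) ^+ 2 * c) by ring.
    by rewrite cc (_ : _ * (_ * c) = 2%:R * U ^+ 4 * c); [rewrite U4 mulr1 | ring].
  - exact: dvc_mulrn.
  - have cm m : (1 - U) ^+ (2 * m) * c = (- 2%:R * U) ^+ m * c.
      elim: m => [|m IH]; first by rewrite muln0 !expr0.
      by rewrite mulnS exprD -mulrA IH mulrCA cc exprS; ring.
    by rewrite (cm 6); ring.
rewrite expn1 in hy.
apply: (multiplier_rel _ hA tc hy) => // z.
apply: unit_rel2 => //.
by rewrite -u4 !mulrS mulr0n addr0 !addrA.
Qed.

(** The image X in Z[C_4] satisfies X = e [g] X and [2] X = - X. An odd g would give X = [2 g] X =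
    [2] X = - X, so g is 0 or 2 modulo 4. It is 2 exactly when e = -1, and then adding h to g
    absorbs the sign. *)
Lemma shift4_con (n t : nat) (f : gring 'I_n.+1) g (e : int) (h : 'I_n.+1) :
  (4 %| n.+1)%N -> (t = 1 %[mod 4])%N -> e = 1 \/ e = -1 -> con 3 f != 0 ->
  (h = 2 %[mod 4])%N -> gsingle h * f = - f ->
  frob t f = (gsingle g * f) *~ e -> exists2 g' : 'I_n.+1, (4 %| g')%N & frob t f = gsingle g' * f.
Proof.
move=> mn ht he X0 hh hhf hf; set X := con 3 f in X0.
have hX : X = (gsingle (red 3 g) * X) *~ e.
  have : con 3 (frob t f) = con 3 ((gsingle g * f) *~ e) by rewrite hf.
  rewrite con_frob // raddfMz /= conM // con_single // -/X => <-.
  rewrite (@frob_mod _ _ 1) //; symmetry; apply: push_id => x.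
  by rewrite mulr1n.
have h2 : red 3 h = 1 + 1 by apply: val_inj; rewrite /= hh.
have X2 : gsingle (1 + 1) * X = - X.
  have : con 3 (gsingle h * f) = con 3 (- f) by rewrite hhf.
  by rewrite conM // con_single // h2 raddfN.
have Xn : X = - X -> False.
  move=> e'; move/negP: X0; apply; apply/eqP/gringP => x.
  by have := congr1 (fun f : gring 'I_4 => f x) e'; rewrite gringN gring0; lia.
have ee : e * e = 1 by case: he => ->.
have XX : X = gsingle (red 3 g + red 3 g) * X.
  by rewrite -gsingleM -mulrA {1}hX {1}hX mulrzAr -mulrzA ee mulr1z.
have red_dvd (x : 'I_n.+1) : red 3 x = 0 -> (4 %| x)%N.
  by move=> /(congr1 val) /= h'; rewrite /dvdn h'.
have g4 : red 3 g = 0 \/ red 3 g = 1 + 1.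
  case er : (red 3 g) XX => [[|[|[|[|m]]]] hm] // XX.
  - by left; apply: val_inj.
  - exfalso; apply: Xn; rewrite {1}XX -X2; congr (gsingle _ * _); exact: val_inj.
  - by right; apply: val_inj.
  - exfalso; apply: Xn; rewrite {1}XX -X2; congr (gsingle _ * _); exact: val_inj.
case: g4 => hg; rewrite hg in hX.
  exists g; first exact: red_dvd.
  case: he => e1; first by rewrite hf e1.
  by case: Xn; rewrite {1}hX e1 mulrN1z gsingle0 mul1r.
exists (g + h).
  by apply: red_dvd; rewrite redD // hg h2; apply: val_inj.
rewrite -gsingleM -mulrA hhf mulrN hf; case: he => e1; rewrite e1 ?mulrN1z //.
by case: Xn; rewrite {1}hX e1 mulr1z X2.
Qed.

Definition anti_corr n k (f : gring 'I_n.+1) : Prop :=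
  let h : 'I_n.+1 := inZp n.+1./2 in
  f * star f = k%:R * ((1 - gsingle h) * star (1 - gsingle h)).

(** For even m + 1 the congruence says that the quotient is by a subgroup of odd order, so the
    involution of the group survives in it. *)
Lemma anti_corr_con n m k (f : gring 'I_n.+1) : (m.+1 %| n.+1)%N ->
  (n.+1./2 = m.+1./2 %[mod m.+1])%N -> anti_corr k f -> anti_corr k (con m f).
Proof.
move=> mn hh hf; rewrite /anti_corr (@con_corr n m _ _ mn hf) conM // con_nat // conM // con_star //.
rewrite (raddfB (con m)) /= con1 // con_single.
suff -> : red m (inZp n.+1./2 : 'I_n.+1) = inZp m.+1./2 by [].
by apply: val_inj; rewrite /= modn_dvdm.
Qed.

Lemma feasible_anti n t u b k (ms : seq nat) (f : gring 'I_n.+1) :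
  (t * u = 1 %[mod n.+1])%N -> frob t f = f -> (forall g, `|f g| <= b%:Z) ->
  ~~ odd n.+1 -> all (fun m => m.+1 %| n.+1)%N ms -> anti_corr k f ->
  feasible t n.+1 [seq m.+1 | m <- ms] (anti n.+1 (Z.of_nat k)) (range b)
    [seq lst (con m f) | m <- ms] (lst f).
Proof.
move=> htu hf hb hn hms hk; apply: (feasible_lst htu hf hms).
  by move=> i hi; apply: mem_range.
by move=> s hs; rewrite hk; apply: nth_anti.
Qed.

Lemma anti_translate n w t q r (A : gring 'I_n.+1) :
  n.+1 = (4 * w)%N -> odd w -> t = (2 + w * q)%N -> (t = 1 %[mod 4])%N ->
  (0 < r)%N -> powm t r n.+1 = (1 %% n.+1)%N ->
  (forall g, `|A g| <= 1) -> A * star A = 64%:R ->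
  exists F : gring 'I_n.+1, [/\ forall g, `|F g| <= 2, frob t F = F,
    anti_corr 64 F & con (2 * w).-1 F = 0].
Proof.
move=> hn hw ht ht4 r0 hr hb hA.
have w0 : (0 < w)%N by case: (w) hw.
pose u : 'I_n.+1 := inZp w; pose h : 'I_n.+1 := inZp n.+1./2.
have hn2 : n.+1./2 = (2 * w)%N by rewrite hn; lia.
have uv : val u = w by rewrite /u; apply: modn_small; lia.
have hv : val h = (2 * w)%N by rewrite /h hn2; apply: modn_small; lia.
have uu : u + u = h.
  by apply: val_inj; rewrite hv; apply: etrans (modnDm _ _ _) _; rewrite modn_small; lia.
have uM k : u *+ k = inZp (w * k) by rewrite Zp_mulrn (uv : nat_of_ord u = w).
have u0 : u + u != 0 by rewrite uu -val_eqE hv /=; lia.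
have u4 : u *+ 4 = 0.
  by rewrite uM; apply: val_inj; rewrite /= [(w * 4)%N]mulnC -hn modnn.
have ut : u *+ t = u.
  rewrite (divn_eq t 4) mulrnDr mulnC mulrnA u4 mul0rn add0r ht4.
  by rewrite modn_small // mulr1n.
have htk (g : 'I_n.+1) : exists k, g *+ t = g *+ 2 + u *+ k.
  exists (g * q)%N; rewrite ht mulrnDr; congr (_ + _).
  by rewrite uM Zp_mulrn mulnCA.
have htr (g : 'I_n.+1) : g *+ (t ^ r) = g by apply: ord_mulrn_pow.
have [g [e [he hf]]] := frob_rel4 u0 u4 r0 htr ut htk hA.
rewrite uu in hf; set c := 1 - gsingle h in hf.
have n4 : (4 %| n.+1)%N by rewrite hn dvdn_mulr.
have hc : gsingle h * (A * c) = - (A * c).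
  have hh : h + h = 0.
    by rewrite -uu -u4 !mulrS mulr0n addr0 !addrA.
  by rewrite mulrCA /c mulrBr mulr1 gsingleM hh gsingle0 -mulrN opprB.
have h4 : (h = 2 %[mod 4])%N by rewrite (hv : nat_of_ord h = _); lia.
have fcorr : anti_corr 64 (A * c).
  by rewrite /anti_corr -/h -/c rmorphM /= mulrACA hA.
have X0 : con 3 (A * c) != 0.
  apply/eqP => h'; have : con 3 (A * star A) * (con 3 c * star (con 3 c)) = 0.
    by rewrite conM // con_star // mulrACA -(conM (m := 3)) // h' mul0r.
  have -> : con 3 c = 1 - gsingle (inZp 2).
    rewrite (raddfB (con 3)) /= con1 // con_single; congr (_ - gsingle _).
    by apply: val_inj; rewrite /= h4.
  rewrite hA con_nat // mulr_natl => /(congr1 (fun f : gring 'I_4 => f 0)).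
  rewrite gringMn corr0E !big_ord_recl big_ord0 !gaddE !gringN -!gsingle0 !gsingleE.
  by rewrite gring0.
have [g' g4 hg'] := shift4_con n4 ht4 he X0 h4 hc hf.
(* t - 2 is a multiple of w and 4 divides g', so (t - 2) g' vanishes modulo 4 w; hence translation
   by - g' yields a fixed element. *)
have g't : g' *+ t = g' + g'.
  rewrite ht mulrnDr mulr2n -[RHS]addr0; congr (_ + _).
  rewrite Zp_mulrn; apply: val_inj; apply/eqP; rewrite /= -/(dvdn _ _).
  have [a ha] := dvdnP g4; rewrite ha {1}hn.
  have -> : (a * 4 * (w * q) = a * q * (4 * w))%N by lia.
  exact: dvdn_mull.
have hx : - g' *+ t + g' = - g' by rewrite mulNrn g't opprD subrK.
have w2 : ((2 * w).-1.+1 = 2 * w)%N by rewrite prednK // muln_gt0.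
have wn : ((2 * w).-1.+1 %| n.+1)%N by rewrite w2 hn -[4%N]/(2 * 2)%N -mulnA dvdn_mull.
exists (gsingle (- g') * (A * c)); split.
- move=> k; rewrite gsingleMl /c mulrBr mulr1 gaddE gringN mulrC gsingleMl.
  by apply: le_trans (ler_normB _ _) _; apply: (lerD (hb _) (hb _)).
- exact: frob_translate hg' hx.
- by rewrite /anti_corr corr_single.
- rewrite conM // conM // (raddfB (con _)) /= con1 // (con_single _ h).
  rewrite (_ : red _ h = 0) ?gsingle0 ?subrr ?mulr0 //; apply: val_inj.
  by change (h %% (2 * w).-1.+1 = 0)%N; rewrite (hv : nat_of_ord h = _) w2 modnn.
Qed.

Lemma icw20P (F : gring 'I_20) : (forall g, `|F g| <= 14) -> frob 37 F = F ->
  anti_corr 64 F -> con 9 F = 0 -> lst F \in icw20.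
Proof.
move=> hb hf hF h0.
have st : stage_ok 37 20 10 [:: 10%N] (anti 20 (Z.of_nat 64)) by vm_compute.
apply: (solveP st (mem_head _ _)).
have -> : [:: nseq 10 Z0] = [seq lst (con m F) | m <- [:: 9%N]] by rewrite /= h0 lst0.
exact: (@feasible_anti 19 37 13 14 64 [:: 9%N] F).
Qed.

Lemma no_CW_140_64 (A : gring 'I_140) : (forall g, `|A g| <= 1) ->
  A * star A = 64%:R -> False.
Proof.
move=> hb hA.
have [F [bF fF cF h0]] :=
  @anti_translate 139 35 37 1 12 A erefl isT erefl erefl isT erefl hb hA.
have h20 : lst (con 19 F) \in icw20.
  apply: icw20P.
  - by move=> g; have := @con_bound 139 19 isT _ _ bF g.
  - by rewrite -con_frob // fF.
  - exact: (@anti_corr_con 139 19 64 F).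
  - by rewrite con_con // -(@con_con 139 9 69 F isT) h0 raddf0.
have st : stage_ok 37 140 10 [:: 70%N; 20%N] (anti 140 (Z.of_nat 64)) by vm_compute.
suff : lst F \in cw140 by rewrite cw140_nil.
apply: (solveP st h20).
have -> : [:: nseq 70 Z0; lst (con 19 F)] = [seq lst (con m F) | m <- [:: 69%N; 19%N]].
  by rewrite /= h0 lst0.
exact: (@feasible_anti 139 37 53 2 64 [:: 69%N; 19%N] F).
Qed.

Lemma icw12P (F : gring 'I_12) : (forall g, `|F g| <= 30) -> frob 137 F = F ->
  anti_corr 64 F -> con 5 F = 0 -> lst F \in icw12.
Proof.
move=> hb hf hF h0.
have st : stage_ok 137 12 6 [:: 6%N] (anti 12 (Z.of_nat 64)) by vm_compute.
apply: (solveP st (mem_head _ _)).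
have -> : [:: nseq 6 Z0] = [seq lst (con m F) | m <- [:: 5%N]] by rewrite /= h0 lst0.
exact: (@feasible_anti 11 137 5 30 64 [:: 5%N] F).
Qed.

Lemma icw36P (F : gring 'I_36) : (forall g, `|F g| <= 10) -> frob 137 F = F ->
  anti_corr 64 F -> con 17 F = 0 -> lst F \in icw36.
Proof.
move=> hb hf hF h0.
have h12 : lst (con 11 F) \in icw12.
  apply: icw12P.
  - by move=> g; have := @con_bound 35 11 isT _ _ hb g.
  - by rewrite -con_frob // hf.
  - exact: (@anti_corr_con 35 11 64 F).
  - by rewrite con_con // -(@con_con 35 5 17 F isT) h0 raddf0.
have st : stage_ok 137 36 6 [:: 18%N; 12%N] (anti 36 (Z.of_nat 64)) by vm_compute.
apply: (solveP st h12).
have -> : [:: nseq 18 Z0; lst (con 11 F)] = [seq lst (con m F) | m <- [:: 17%N; 11%N]].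
  by rewrite /= h0 lst0.
exact: (@feasible_anti 35 137 5 10 64 [:: 17%N; 11%N] F).
Qed.

Lemma no_CW_180_64 (A : gring 'I_180) : (forall g, `|A g| <= 1) ->
  A * star A = 64%:R -> False.
Proof.
move=> hb hA.
have [F [bF fF cF h0]] :=
  @anti_translate 179 45 137 3 12 A erefl isT erefl erefl isT erefl hb hA.
have h36 : lst (con 35 F) \in icw36.
  apply: icw36P.
  - by move=> g; have := @con_bound 179 35 isT _ _ bF g.
  - by rewrite -con_frob // fF.
  - exact: (@anti_corr_con 179 35 64 F).
  - by rewrite con_con // -(@con_con 179 17 89 F isT) h0 raddf0.
have st : stage_ok 137 180 18 [:: 90%N; 36%N] (anti 180 (Z.of_nat 64)) by vm_compute.
suff : lst F \in cw180 by rewrite cw180_nil.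
apply: (solveP st h36).
have -> : [:: nseq 90 Z0; lst (con 35 F)] = [seq lst (con m F) | m <- [:: 89%N; 35%N]].
  by rewrite /= h0 lst0.
exact: (@feasible_anti 179 137 113 2 64 [:: 89%N; 35%N] F).
Qed.

Lemma icw28P (F : gring 'I_28) : (forall g, `|F g| <= 14) -> frob 149 F = F ->
  anti_corr 64 F -> con 13 F = 0 -> lst F \in icw28.
Proof.
move=> hb hf hF h0.
have st : stage_ok 149 28 14 [:: 14%N] (anti 28 (Z.of_nat 64)) by vm_compute.
apply: (solveP st (mem_head _ _)).
have -> : [:: nseq 14 Z0] = [seq lst (con m F) | m <- [:: 13%N]] by rewrite /= h0 lst0.
exact: (@feasible_anti 27 149 25 14 64 [:: 13%N] F).
Qed.

Lemma no_CW_196_64 (A : gring 'I_196) : (forall g, `|A g| <= 1) ->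
  A * star A = 64%:R -> False.
Proof.
move=> hb hA.
have [F [bF fF cF h0]] :=
  @anti_translate 195 49 149 3 21 A erefl isT erefl erefl isT erefl hb hA.
have h28 : lst (con 27 F) \in icw28.
  apply: icw28P.
  - by move=> g; have := @con_bound 195 27 isT _ _ bF g.
  - by rewrite -con_frob // fF.
  - exact: (@anti_corr_con 195 27 64 F).
  - by rewrite con_con // -(@con_con 195 13 97 F isT) h0 raddf0.
have st : stage_ok 149 196 14 [:: 98%N; 28%N] (anti 196 (Z.of_nat 64)) by vm_compute.
suff : lst F \in cw196 by rewrite cw196_nil.
apply: (solveP st h28).
have -> : [:: nseq 98 Z0; lst (con 27 F)] = [seq lst (con m F) | m <- [:: 97%N; 27%N]].
  by rewrite /= h0 lst0.
exact: (@feasible_anti 195 149 25 2 64 [:: 97%N; 27%N] F).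
Qed.

(** * Weight 49 *)

(** Integer circulant weighing matrices: passing to a quotient keeps the correlation but only a
    bound on the coefficients. *)
Definition icw n (t b k : nat) (f : gring 'I_n.+1) : Prop :=
  [/\ forall g, `|f g| <= b%:Z, frob t f = f & f * star f = k%:R].

Lemma feasible_icw n t u b k (ms : seq nat) (f : gring 'I_n.+1) :
  (t * u = 1 %[mod n.+1])%N -> all (fun m => m.+1 %| n.+1)%N ms -> icw t b k f ->
  feasible t n.+1 [seq m.+1 | m <- ms] (single n.+1 (Z.of_nat k)) (range b)
    [seq lst (con m f) | m <- ms] (lst f).
Proof.
move=> htu hms [hb hf hk]; apply: (feasible_lst htu hf hms).
  by move=> i hi; apply: mem_range.
by move=> s hs; rewrite hk; apply: nth_single.
Qed.

Lemma icw_con n m t b k (f : gring 'I_n.+1) : (m.+1 %| n.+1)%N ->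
  icw t b k f -> icw t (b * (n.+1 %/ m.+1)) k (con m f).
Proof.
move=> mn [hb hf hk]; split.
- by move=> g; rewrite PoszM -[X in _ * X]natz; apply: con_bound.
- by rewrite -con_frob // hf.
- by rewrite (@con_corr n m f _ mn hk) con_nat.
Qed.

Lemma icw49_fixed n u r (A : gring 'I_n.+1) : (7 * u = 1 %[mod n.+1])%N ->
  (0 < r)%N -> powm 7 r n.+1 = (1 %% n.+1)%N ->
  (forall g, `|A g| <= 1) -> A * star A = 49%:R ->
  exists2 A' : gring 'I_n.+1, icw 7 1 49 A' & lst (con 0 A') = [:: Z_of_int 7].
Proof.
move=> hu r0 hr hb hA.
have [x [e [he hf ha]]] := @fixed_translate n 7 u A isT hu (ex_intro2 _ _ r r0 hr) hA.
exists ((gsingle x * A) *~ e); last by rewrite lst_con0 ha.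
split=> //.
  move=> g; rewrite gringMz gsingleMl; case: he => ->; rewrite ?mulr1z ?mulrN1z ?normrN; apply: hb.
have -> : (gsingle x * A) *~ e * star ((gsingle x * A) *~ e) =
    (gsingle x * A) * star (gsingle x * A).
  by case: he => ->; rewrite ?mulr1z // mulrN1z raddfN /= mulrNN.
by rewrite corr_single.
Qed.

Lemma no_CW_116_49 (A : gring 'I_116) : (forall g, `|A g| <= 1) ->
  A * star A = 49%:R -> False.
Proof.
move=> hb hA.
have [B hB h1] := @icw49_fixed 115 83 14 A erefl isT erefl hb hA.
have h29 : lst (con 28 B) \in icw29.
  have st : stage_ok 7 29 1 [:: 1%N] (single 29 (Z.of_nat 49)) by vm_compute.
  have h0 : lst (con 0 (con 28 B)) \in [:: [:: Z_of_int 7]].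
    by rewrite (@con_con 115 0 28 B isT) h1 mem_head.
  apply: (solveP st h0).
  exact: (@feasible_icw 28 7 25 4 49 [:: 0%N] _ erefl isT (@icw_con 115 28 7 1 49 B isT hB)).
have h58 : lst (con 57 B) \in icw58.
  have st : stage_ok 7 58 29 [:: 29%N] (single 58 (Z.of_nat 49)) by vm_compute.
  apply: (solveP st h29); rewrite -(@con_con 115 28 57 B isT).
  exact: (@feasible_icw 57 7 25 2 49 [:: 28%N] _ erefl isT (@icw_con 115 57 7 1 49 B isT hB)).
have st : stage_ok 7 116 58 [:: 58%N] (single 116 (Z.of_nat 49)) by vm_compute.
suff : lst B \in cw116 by rewrite cw116_nil.
apply: (solveP st h58).
exact: (@feasible_icw 115 7 83 1 49 [:: 57%N] B erefl isT hB).
Qed.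

Lemma no_CW_120_49 (A : gring 'I_120) : (forall g, `|A g| <= 1) ->
  A * star A = 49%:R -> False.
Proof.
move=> hb hA.
have [B hB h1] := @icw49_fixed 119 103 4 A erefl isT erefl hb hA.
have h3 : lst (con 2 B) \in icw3.
  have st : stage_ok 7 3 1 [:: 1%N] (single 3 (Z.of_nat 49)) by vm_compute.
  have h0 : lst (con 0 (con 2 B)) \in [:: [:: Z_of_int 7]].
    by rewrite (@con_con 119 0 2 B isT) h1 mem_head.
  apply: (solveP st h0).
  exact: (@feasible_icw 2 7 1 40 49 [:: 0%N] _ erefl isT (@icw_con 119 2 7 1 49 B isT hB)).
have h15 : lst (con 14 B) \in icw15.
  have st : stage_ok 7 15 3 [:: 3%N] (single 15 (Z.of_nat 49)) by vm_compute.
  apply: (solveP st h3); rewrite -(@con_con 119 2 14 B isT).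
  exact: (@feasible_icw 14 7 13 8 49 [:: 2%N] _ erefl isT (@icw_con 119 14 7 1 49 B isT hB)).
have h30 : lst (con 29 B) \in icw30.
  have st : stage_ok 7 30 15 [:: 15%N] (single 30 (Z.of_nat 49)) by vm_compute.
  apply: (solveP st h15); rewrite -(@con_con 119 14 29 B isT).
  exact: (@feasible_icw 29 7 13 4 49 [:: 14%N] _ erefl isT (@icw_con 119 29 7 1 49 B isT hB)).
have st : stage_ok 7 60 30 [:: 30%N] (single 60 (Z.of_nat 49)) by vm_compute.
suff : lst (con 59 B) \in icw60 by rewrite icw60_nil.
apply: (solveP st h30); rewrite -(@con_con 119 29 59 B isT).
exact: (@feasible_icw 59 7 43 2 49 [:: 29%N] _ erefl isT (@icw_con 119 59 7 1 49 B isT hB)).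
Qed.

(** * Elements supported on a subgroup *)

Section Restriction.
Variables (d n m : nat).
Hypothesis nm : n.+1 = (d * m.+1)%N.

Definition emb (z : 'I_m.+1) : 'I_n.+1 := inZp (d * z).

Lemma d_gt0 : (0 < d)%N. Proof. by case: d nm. Qed.

Lemma emb_val z : emb z = (d * z)%N :> nat.
Proof. by apply: modn_small; rewrite nm ltn_pmul2l ?d_gt0 ?ltn_ord. Qed.

Lemma emb_inj : injective emb.
Proof.
move=> x y /(congr1 (@nat_of_ord _)); rewrite !emb_val => /eqP.
by rewrite eqn_pmul2l ?d_gt0 // => /eqP h; apply: ord_inj.
Qed.

Lemma embD : {morph emb : x y / x + y}.
Proof.
move=> x y; apply: ord_inj; rewrite emb_val.
change (d * ((x + y) %% m.+1) = (emb x + emb y) %% n.+1)%N.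
by rewrite !emb_val -mulnDr nm muln_modr.
Qed.

Lemma embN : {morph emb : x / - x}.
Proof.
move=> x; have e0 : emb 0 = 0 by apply: ord_inj; rewrite emb_val muln0.
by apply/eqP; rewrite -subr_eq0 opprK -embD addNr e0.
Qed.

Lemma embMn x k : emb (x *+ k) = emb x *+ k.
Proof.
elim: k => [|k IH]; last by rewrite !mulrS embD IH.
by rewrite !mulr0n; apply: ord_inj; rewrite emb_val muln0.
Qed.

Definition restrict (f : gring 'I_n.+1) : gring 'I_m.+1 := [ffun z => f (emb z)].

Variable f : gring 'I_n.+1.
Hypothesis f_supp : forall k : 'I_n.+1, ~~ (d %| k)%N -> f k = 0.

Lemma push_restrict : push emb (restrict f) = f.
Proof.
apply: gringP => k; case: (boolP (d %| k)%N) => hk; last first.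
  rewrite f_supp // pushE big1 // => z /eqP hz; exfalso.
  by move: hk; rewrite -hz emb_val dvdn_mulr.
have hz : (k %/ d < m.+1)%N by rewrite ltn_divLR ?d_gt0 // mulnC -nm ltn_ord.
have -> : k = emb (Ordinal hz).
  by apply: ord_inj; rewrite emb_val /= mulnC divnK.
by rewrite push_inj ?ffunE //; apply: emb_inj.
Qed.

Lemma restrict_frob t : frob t f = f -> frob t (restrict f) = restrict f.
Proof.
move=> hf; apply: gringP => z.
have h : push emb (frob t (restrict f)) = frob t (push emb (restrict f)).
  by rewrite /frob !push_comp; apply: eq_push => x /=; rewrite embMn.
rewrite -(push_inj (frob t (restrict f)) z emb_inj) h push_restrict hf.
by rewrite ffunE.
Qed.

Lemma restrict_corr z : (restrict f * star (restrict f)) z = (f * star f) (emb z).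
Proof.
rewrite -[in RHS]push_restrict -push_star; last exact: embN.
rewrite -pushM; last exact: embD.
by rewrite push_inj //; apply: emb_inj.
Qed.

End Restriction.

Lemma restrict_anti d n m k (f : gring 'I_n.+1) : n.+1 = (d * m.+1)%N ->
  (forall k : 'I_n.+1, ~~ (d %| k)%N -> f k = 0) ->
  @emb d n m (inZp m.+1./2 : 'I_m.+1) = inZp n.+1./2 ->
  anti_corr k f -> anti_corr k (restrict d m f).
Proof.
move=> nm hs he hf; apply: gringP => z.
rewrite restrict_corr // hf -[in RHS](push_inj _ z (emb_inj nm)).
rewrite pushM; last exact: embD.
rewrite pushM; last exact: embD.
have p1 : push (@emb d n m) (1 : gring 'I_m.+1) = 1.
  by apply: push1; apply: ord_inj; rewrite (emb_val nm) muln0.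
rewrite push_star; last exact: embN.
have -> : push (@emb d n m) (1 - gsingle (inZp m.+1./2)) = 1 - gsingle (inZp n.+1./2).
  by rewrite (raddfB (push _)) /= p1 push_single he.
by rewrite (raddfMn (push _)) /= p1.
Qed.

Lemma mem_sums (x y : int) : `|x| <= 1 -> `|y| <= 1 ->
  Z_of_int (x + y) \in sums (Z_of_int (x - y)).
Proof.
move=> hx hy.
have [hx'|[hx'|hx']] : x = 0 \/ x = 1 \/ x = -1 by lia.
all: have [hy'|[hy'|hy']] : y = 0 \/ y = 1 \/ y = -1 by lia.
all: by rewrite hx' hy'.
Qed.

Lemma mem_quadruple (x : int) : `|x| <= 1 ->
  Z_of_int (2 * x + 2 * x) \in [:: Zneg 4; Z0; Zpos 4].
Proof. by move=> hx; have [->|[->|->]] : x = 0 \/ x = 1 \/ x = -1 by lia. Qed.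

Lemma mem_even_range (a : int) b k : ~~ odd b -> `|a| <= b%:Z ->
  (odd k -> exists c, a = 2 * c) -> Z_of_int a \in even_range b k.
Proof.
move=> hb ha hk; rewrite /even_range; case: ifP => [/hk [c hc]|_]; last exact: mem_range.
apply/mapP; exists (Z_of_int c); last by rewrite hc; lia.
by apply: mem_range; lia.
Qed.

Lemma corr_anti_part n k (f : gring 'I_n.+1) : f * star f = k%:R ->
  anti_corr k (f * (1 - gsingle (inZp n.+1./2))).
Proof. by move=> hf; rewrite /anti_corr rmorphM /= mulrACA hf. Qed.

Lemma frob_anti_part n t (f : gring 'I_n.+1) : (n.+1./2 * t = n.+1./2 %[mod n.+1])%N ->
  frob t f = f ->
  frob t (f * (1 - gsingle (inZp n.+1./2))) = f * (1 - gsingle (inZp n.+1./2)).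
Proof.
move=> ht hf; rewrite rmorphM rmorphB rmorph1 /= frob_single hf; congr (_ * (_ - gsingle _)).
by rewrite Zp_mulrn; apply: val_inj; rewrite /= modnMml ht.
Qed.

Lemma anti_partE n (f : gring 'I_n.+1) k : ~~ odd n.+1 ->
  (f * (1 - gsingle (inZp n.+1./2))) (inZp k) = f (inZp k) - f (inZp (k + n.+1./2)).
Proof.
move=> /even_halfK; move: n.+1./2 => h hh.
rewrite mulrBr mulr1 gaddE gringN mulrC gsingleMl; congr (_ - f _).
apply/eqP; rewrite subr_eq; apply/eqP; apply: val_inj => /=.
by rewrite modnDm -addnA addnn hh modnDr.
Qed.

(** * Order 192 *)

Section Order192.
Variable B : gring 'I_192.
Hypothesis B_le1 : forall g, `|B g| <= 1.
Hypothesis B_fix : frob 7 B = B.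
Hypothesis B_corr : B * star B = 49%:R.

Let b (k : nat) : int := B (inZp k).

Lemma b_mod j k : (j = k %[mod 192])%N -> b j = b k.
Proof. by move=> h; congr (B _); apply: val_inj. Qed.

Lemma b49 k : b (k * 49) = b k.
Proof.
have h x : B (x *+ 7) = B x by apply: (frob_fixE (u := 55)).
transitivity (B (inZp k *+ 7 *+ 7)); last by rewrite !h.
rewrite -mulrnA Zp_mulrn; congr (B _); apply: val_inj.
by change (k * 49 %% 192 = (k %% 192) * (7 * 7) %% 192)%N; rewrite modnMml.
Qed.

(** Multiplication by 49 adds 48 k, which for odd k is 48 or -48 modulo 192. *)
Lemma b_odd k : odd k -> b (k + 48) = b k.
Proof.
move=> hk; have [h1|h3] : (k %% 4 = 1 \/ k %% 4 = 3)%N by lia.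
  by rewrite -[RHS]b49; apply: b_mod; lia.
by rewrite -b49; apply: b_mod; lia.
Qed.

Lemma b_even k : (k %% 4 = 2)%N -> b (k + 96) = b k.
Proof. by move=> hk; rewrite -[RHS]b49; apply: b_mod; lia. Qed.

Let s (k : nat) : int := b k + b (k + 96).

Lemma con95E k : con 95 B (inZp k) = s k.
Proof.
have := @con_half 95 B (inZp k : 'I_192); rewrite /s /b => h.
have -> : inZp k = inZp (inZp k : 'I_192) :> 'I_96.
  by apply: val_inj; rewrite /= modn_dvdm.
rewrite {}h; congr (_ + B _); apply: val_inj.
by change ((k %% 192 + 96) %% 192 = (k + 96) %% 192)%N; rewrite modnDml.
Qed.

Lemma con47E k : con 47 B (inZp k) = s k + s (k + 48).
Proof.
rewrite -(@con_con 191 47 95 B isT); set S := con 95 B.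
have := @con_half 47 S (inZp k : 'I_96) => h.
have -> : inZp k = inZp (inZp k : 'I_96) :> 'I_48.
  by apply: val_inj; rewrite /= modn_dvdm.
rewrite {}h -!con95E; congr (_ + S _); apply: val_inj.
by change ((k %% 96 + 48) %% 96 = (k + 48) %% 96)%N; rewrite modnDml.
Qed.

Let F192 := B * (1 - gsingle (inZp 96)).
Let F := restrict 4 47 F192.

Lemma F192E k : F192 (inZp k) = b k - b (k + 96).
Proof. exact: (@anti_partE 191 B k). Qed.

Lemma F192_supp (k : 'I_192) : ~~ (4 %| k)%N -> F192 k = 0.
Proof.
move=> hk; rewrite -[k]valZpK F192E.
have [h|h] : odd k \/ (k %% 4 = 2)%N by rewrite /dvdn in hk; lia.
  have -> : (k + 96 = k + 48 + 48)%N by rewrite -addnA.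
  by rewrite !b_odd ?subrr // oddD h.
by rewrite b_even // subrr.
Qed.

Lemma FE z : F (inZp z) = b (4 * z) - b (4 * z + 96).
Proof.
rewrite ffunE -F192E; congr (F192 _); apply: val_inj.
change (4 * (z %% 48) %% 192 = 4 * z %% 192)%N.
by rewrite -[192%N]/(4 * 48)%N -!muln_modr // modn_mod.
Qed.

Lemma b_le1 k : `|b k| <= 1. Proof. exact: B_le1. Qed.

Lemma F_fix : frob 7 F = F.
Proof.
apply: restrict_frob => //; first exact: F192_supp.
exact: (@frob_anti_part 191 7 B).
Qed.

Lemma F_anti : anti_corr 49 F.
Proof.
apply: (@restrict_anti 4 191 47 49 F192 erefl F192_supp _ _).
  by apply: val_inj.
exact: (@corr_anti_part 191 49 B).
Qed.

(** Passing from z to z + 24 exchanges the two terms of F, so F(z + 24) = - F(z). *)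
Lemma F_half : con 23 F = 0.
Proof.
apply: gringP => k; rewrite gring0 -[k]valZpK.
have -> : inZp k = inZp (inZp k : 'I_48) :> 'I_24.
  by apply: val_inj; rewrite /= modn_dvdm.
rewrite (@con_half 23 F (inZp k : 'I_48)).
have -> : inZp k + inZp 24 = inZp (k + 24) :> 'I_48.
  by apply: val_inj; rewrite /= modnDm.
rewrite !FE (_ : b (4 * (k + 24)) = b (4 * k + 96)); last by apply: b_mod; lia.
rewrite (_ : b (4 * (k + 24) + 96) = b (4 * k)); last by apply: b_mod; lia.
by rewrite addrC subrKA subrr.
Qed.

Lemma F_bound g : `|F g| <= 2.
Proof.
rewrite -[g]valZpK FE; have := b_le1 (4 * g); have := b_le1 (4 * g + 96).
by move: (b _) (b _) => x y; lia.
Qed.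

Lemma F_mem : lst F \in icw48.
Proof.
have h16 : lst (con 15 F) \in icw16.
  have h_fix : frob 7 (con 15 F) = con 15 F by rewrite -con_frob // F_fix.
  have h_bound g : `|con 15 F g| <= 6 by have := @con_bound 47 15 isT _ _ F_bound g.
  have h_anti := @anti_corr_con 47 15 49 F isT erefl F_anti.
  have st : stage_ok 7 16 8 [:: 8%N] (anti 16 (Z.of_nat 49)) by vm_compute.
  apply: (solveP st (mem_head _ _)).
  have -> : [:: nseq 8 Z0] = [seq lst (con m (con 15 F)) | m <- [:: 7%N]].
    rewrite /= (@con_con 47 7 15 F isT) -(@con_con 47 7 23 F isT) F_half.
    by rewrite raddf0 lst0.
  exact: (@feasible_anti 15 7 7 6 49 [:: 7%N] (con 15 F) erefl h_fix h_bound isT isT h_anti).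
have st : stage_ok 7 48 8 [:: 16%N; 24%N] (anti 48 (Z.of_nat 49)) by vm_compute.
apply: (solveP st h16).
have -> : [:: lst (con 15 F); nseq 24 Z0] = [seq lst (con m F) | m <- [:: 15%N; 23%N]].
  by rewrite /= F_half lst0.
exact: (@feasible_anti 47 7 7 2 49 [:: 15%N; 23%N] F erefl F_fix F_bound isT isT F_anti).
Qed.

Let S := con 95 B.
Let F96 := S * (1 - gsingle (inZp 48)).
Let G := restrict 2 47 F96.

Lemma s_odd k : odd k -> s k = 2 * b k.
Proof.
move=> hk; rewrite /s (_ : k + 96 = k + 48 + 48)%N; last by rewrite -addnA.
by rewrite !b_odd ?oddD ?hk //; ring.
Qed.

Lemma s_even k : (k %% 4 = 2)%N -> s k = 2 * b k.
Proof. by move=> hk; rewrite /s b_even //; ring. Qed.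

Lemma s_mod j k : (j = k %[mod 96])%N -> s j = s k.
Proof. by move=> h; rewrite -!con95E; congr (con 95 B _); apply: val_inj. Qed.

Lemma F96E k : F96 (inZp k) = s k - s (k + 48).
Proof. by rewrite -!con95E; exact: (@anti_partE 95 S k). Qed.

Lemma F96_supp (k : 'I_96) : ~~ (2 %| k)%N -> F96 k = 0.
Proof.
rewrite dvdn2 negbK => hk; rewrite -[k]valZpK F96E !s_odd ?oddD ?hk //.
by rewrite b_odd ?subrr.
Qed.

Lemma GE z : G (inZp z) = s (2 * z) - s (2 * z + 48).
Proof.
rewrite ffunE -F96E; congr (F96 _); apply: val_inj.
change (2 * (z %% 48) %% 96 = 2 * z %% 96)%N.
by rewrite -[96%N]/(2 * 48)%N -!muln_modr // modn_mod.
Qed.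

Lemma S_fix : frob 7 S = S.
Proof. by rewrite -con_frob // B_fix. Qed.

Lemma S_corr : S * star S = 49%:R.
Proof. by rewrite (@con_corr 191 95 _ _ isT B_corr) con_nat. Qed.

Lemma S_bound g : `|S g| <= 2.
Proof. by have := @con_bound 191 95 isT _ _ B_le1 g. Qed.

Lemma s_le2 k : `|s k| <= 2.
Proof. by rewrite -con95E; apply: S_bound. Qed.

Lemma G_fix : frob 7 G = G.
Proof.
apply: restrict_frob => //; first exact: F96_supp.
exact: (@frob_anti_part 95 7 S erefl S_fix).
Qed.

Lemma G_anti : anti_corr 49 G.
Proof.
apply: (@restrict_anti 2 95 47 49 F96 erefl F96_supp _ _).
  by apply: val_inj.
exact: (@corr_anti_part 95 49 S S_corr).
Qed.

Lemma G_half : con 23 G = 0.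
Proof.
apply: gringP => k; rewrite gring0 -[k]valZpK.
have -> : inZp k = inZp (inZp k : 'I_48) :> 'I_24.
  by apply: val_inj; rewrite /= modn_dvdm.
rewrite (@con_half 23 G (inZp k : 'I_48)).
have -> : inZp k + inZp 24 = inZp (k + 24) :> 'I_48.
  by apply: val_inj; rewrite /= modnDm.
rewrite !GE (_ : s (2 * (k + 24)) = s (2 * k + 48)); last by apply: s_mod; lia.
rewrite (_ : s (2 * (k + 24) + 48) = s (2 * k)); last by apply: s_mod; lia.
by rewrite addrC subrKA subrr.
Qed.

Lemma G_bound g : `|G g| <= 4.
Proof.
rewrite -[g]valZpK GE; have := s_le2 (2 * g); have := s_le2 (2 * g + 48).
by move: (s _) (s _) => x y; lia.
Qed.

Lemma G_even k : odd k -> exists c, G (inZp k) = 2 * c.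
Proof.
move=> hk; exists (b (2 * k) - b (2 * k + 48)).
by rewrite GE !s_even; [ring | lia | lia].
Qed.

(** As 16 is even, an odd residue modulo 16 has only odd positions over it. *)
Lemma conG_even k : odd k -> exists c, con 15 G (inZp k) = 2 * c.
Proof.
move=> hk; rewrite conE; elim/big_ind: _ => [|x y [c ->] [d ->]|g /eqP hg].
- by exists 0; rewrite mulr0.
- by exists (c + d); rewrite mulrDr.
have og : odd g.
  have := congr1 (@nat_of_ord _) hg; change ((g %% 16 = k %% 16)%N -> odd g); lia.
by rewrite -[g]valZpK; apply: G_even.
Qed.

Lemma feasible_even n c (ms : seq nat) (f : gring 'I_n.+1) :
  (7 * 7 = 1 %[mod n.+1])%N -> frob 7 f = f -> ~~ odd c -> (forall g, `|f g| <= c%:Z) ->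
  (forall k, odd k -> exists x, f (inZp k) = 2 * x) ->
  ~~ odd n.+1 -> all (fun m => m.+1 %| n.+1)%N ms -> anti_corr 49 f ->
  feasible 7 n.+1 [seq m.+1 | m <- ms] (anti n.+1 (Z.of_nat 49)) (even_range c)
    [seq lst (con m f) | m <- ms] (lst f).
Proof.
move=> htu hf hc hb he hn hms hk; apply: (feasible_lst htu hf hms).
  by move=> k hk'; apply: mem_even_range => //; apply: he.
by move=> i hi; rewrite hk; apply: nth_anti.
Qed.

Lemma G_mem : lst G \in icw48e.
Proof.
have h16 : lst (con 15 G) \in icw16e.
  have h_fix : frob 7 (con 15 G) = con 15 G by rewrite -con_frob // G_fix.
  have h_bound g : `|con 15 G g| <= 12 by have := @con_bound 47 15 isT _ _ G_bound g.
  have h_anti := @anti_corr_con 47 15 49 G isT erefl G_anti.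
  have st : stage_ok 7 16 8 [:: 8%N] (anti 16 (Z.of_nat 49)) by vm_compute.
  apply: (solveP st (mem_head _ _)).
  have -> : [:: nseq 8 Z0] = [seq lst (con m (con 15 G)) | m <- [:: 7%N]].
    rewrite /= (@con_con 47 7 15 G isT) -(@con_con 47 7 23 G isT) G_half.
    by rewrite raddf0 lst0.
  exact: (@feasible_even 15 12 [:: 7%N] (con 15 G) erefl h_fix isT h_bound conG_even isT isT h_anti).
have st : stage_ok 7 48 8 [:: 16%N; 24%N] (anti 48 (Z.of_nat 49)) by vm_compute.
apply: (solveP st h16).
have -> : [:: lst (con 15 G); nseq 24 Z0] = [seq lst (con m G) | m <- [:: 15%N; 23%N]].
  by rewrite /= G_half lst0.
exact: (@feasible_even 47 4 [:: 15%N; 23%N] G erefl G_fix isT G_bound G_even isT isT G_anti).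
Qed.

Lemma sums_s m : Z_of_int (s (2 * m)) \in
  sums (if odd m then Z0 else Z_of_int (b (2 * m) - b (2 * m + 96))).
Proof.
case: ifP => hm; last exact: mem_sums (b_le1 _) (b_le1 _).
have h : (2 * m %% 4 = 2)%N by lia.
have := mem_sums (b_le1 (2 * m)) (b_le1 (2 * m + 96)).
by rewrite -/(s (2 * m)) b_even // subrr.
Qed.

(** For odd k, s(k) = s(k + 48) = 2 b(k). For even k, G gives s(k) - s(k + 48), and each of the two
    terms is restricted by the difference of its two coefficients of B. That difference is 0 for k =
    2 modulo 4 and a value of F when 4 divides k. *)
Lemma dom48_mem k : (k < 48)%N ->
  Z_of_int (con 47 B (inZp k)) \in dom48 (lst F) (lst G) k.
Proof.
move=> hk; rewrite con47E /dom48; case: ifP => hodd.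
  by rewrite !s_odd ?oddD ?hodd // b_odd //; apply: mem_quadruple; apply: b_le1.
have [m hm] : exists m, k = (2 * m)%N by exists k./2; lia.
have hm24 : (m < 24)%N by lia.
have -> : k./2 = m by lia.
have gE : nth Z0 (lst G) m = Z_of_int (s k) - Z_of_int (s (k + 48)).
  by rewrite (@nth_lst 47) ?GE -?hm ?raddfB //; lia.
have fE j : (j < 24)%N -> nth Z0 (lst F) j = Z_of_int (b (4 * j) - b (4 * j + 96)).
  by move=> hj; rewrite (@nth_lst 47) ?FE //; lia.
have h1 := sums_s m; have h2 := sums_s (m + 24).
rewrite oddD addbF mulnDr -!hm in h1 h2.
have f1 : (if odd m then Z0 else nth Z0 (lst F) m./2) =
    (if odd m then Z0 else Z_of_int (b k - b (k + 96))).
  case: ifP => // hm2; rewrite fE; last by lia.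
  by have -> : (4 * m./2 = k)%N by lia.
have f2 : (if odd m then Z0 else nth Z0 (lst F) (m./2 + 12)%N) =
    (if odd m then Z0 else Z_of_int (b (k + 2 * 24)%N - b (k + 2 * 24 + 96)%N)).
  case: ifP => // hm2; rewrite fE; last by lia.
  by have -> : (4 * (m./2 + 12) = k + 2 * 24)%N by lia.
apply/mapP; exists (Z_of_int (s k)); last first.
  have -> : Z_of_int (s k + s (k + 48)) = Z_of_int (s k) + Z_of_int (s (k + 48)).
    exact: raddfD.
  by rewrite gE; move: (Z_of_int (s k)) (Z_of_int (s (k + 48))) => x y; lia.
rewrite mem_filter f1 h1 andbT; apply/hasP; exists (Z_of_int (s (k + 48))).
  by rewrite f2.
by rewrite gE; move: (Z_of_int (s k)) (Z_of_int (s (k + 48))) => x y; lia.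
Qed.

Lemma compatibleP : compatible (lst F) (lst G) 24.
Proof.
suff h m : (m <= 24)%N -> compatible (lst F) (lst G) m by exact: h.
elim: m => // m IH hm /=.
have hm48 : (m.*2 < 48)%N by lia.
have := dom48_mem hm48; case: (dom48 _ _ m.*2) => // x t _.
by apply: IH; apply: ltnW.
Qed.

Lemma pairs192_mem : (lst F, lst G) \in pairs192.
Proof.
apply/flatten_mapP; exists (lst F); first exact: F_mem.
by apply: map_f; rewrite mem_filter compatibleP G_mem.
Qed.

Lemma order192_false : False.
Proof.
have h_fix : frob 7 (con 47 B) = con 47 B by rewrite -con_frob // B_fix.
have h_corr : con 47 B * star (con 47 B) = 49%:R.
  by rewrite (@con_corr 191 47 _ _ isT B_corr) con_nat.
have st : stage_ok 7 48 48 [::] (single 48 (Z.of_nat 49)) by vm_compute.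
suff : lst (con 47 B) \in cw192 by rewrite cw192_nil.
apply: (solveP st pairs192_mem).
apply: (@feasible_lst 47 7 7 (con 47 B) [::] _ _ erefl h_fix isT dom48_mem).
by move=> i hi; rewrite h_corr; exact: (@nth_single 47 49 i).
Qed.

End Order192.

Lemma no_CW_192_49 (A : gring 'I_192) : (forall g, `|A g| <= 1) ->
  A * star A = 49%:R -> False.
Proof.
move=> hb hA.
have [B [bB fB cB] _] := @icw49_fixed 191 55 8 A erefl isT erefl hb hA.
exact: (order192_false bB fB cB).
Qed.

Lemma CW_existsP v n :
  (forall A : gring 'I_v.+1, (forall g, `|A g| <= 1) -> A * star A = n%:R -> False) ->
  ~ CW_exists v.+1 n.
Proof.
move=> h [W /CW_gring [A [hA hn]]]; apply: h hn => g.
by move: (hA g); rewrite !inE => /or3P [] /eqP ->.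
Qed.

Theorem theorem1p1 :
  ~ CW_exists 105 36 /\
  ~ CW_exists 140 36 /\
  ~ CW_exists 116 49 /\
  ~ CW_exists 120 49 /\
  ~ CW_exists 192 49 /\
  ~ CW_exists 140 64 /\
  ~ CW_exists 180 64 /\
  ~ CW_exists 196 64.
Proof.
split; first exact: CW_existsP no_CW_105_36.
split; first exact: CW_existsP no_CW_140_36.
split; first exact: CW_existsP no_CW_116_49.
split; first exact: CW_existsP no_CW_120_49.
split; first exact: CW_existsP no_CW_192_49.
split; first exact: CW_existsP no_CW_140_64.
split; first exact: CW_existsP no_CW_180_64.
exact: CW_existsP no_CW_196_64.
Qed.
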